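(* Let $2\le q<\infty$, let $X_1,\dots,X_m$ be Banach spaces over $\mathbb{K}$ and let $Y$ be a Banach space over $\mathbb{K}$ with cotype $q$. Let $1\leq r\leq q$ and let $1\leq n<m$ be integers. If $U\in \mathcal{L}(X_{1},\dots,X_{m};Y)$ is $n$-separately $(r,1)$-summing, then $U$ is $N$-separately $(r_{N},1)$-summing for every integer $N$ with $n<N\leq m$, where $$r_{N}:=\frac{qrN}{nq+(N-n)r}.$$ Moreover, if $n<N<m$, then for each $D\in \mathcal{P}_{N}(m)$ and all $x_{\widehat{D}}\in X^{\widehat{D}}$, $$\pi _{(r_{N},1)}^{N}\left( U_{x_{\widehat{D}}}^{D}\right) \leq \mathrm{A}_{q,r}(Y)^{N-n} \prod_{S\in \mathcal{P}_{n}(D)} \left\Vert \left( U_{x_{\widehat{D}}}^{D}\right)^{S}:X^{D\setminus S} \to \Pi _{(r,1)}^{n}\left( X^{S};Y\right) \right\Vert^{1/\binom{N}{n}},$$ and for $N=m$, $$\pi _{(r_{m},1)}^{m}(U) \leq \mathrm{A}_{q,r}(Y)^{m-n} \prod_{S\in \mathcal{P}_{n}(m)}\left\Vert U^{S}:X^{\widehat{S}}\to \Pi _{(r,1)}^{n}\left( X^{S};Y\right) \right\Vert^{1/\binom{m}{n}}.$$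
   Context: $\mathbb{K}$ is $\mathbb{R}$ or $\mathbb{C}$. $\mathcal{L}(X_1,\dots,X_m;Y)$ is the Banach space of bounded $m$-linear operators $X_1\times\cdots\times X_m\to Y$ with the sup norm over the product of the closed unit balls. Cotype: for $2\le q<\infty$, $Y$ has cotype $q$ if there is $C>0$ such that $\left(\sum_{k=1}^{n}\|y_k\|^q\right)^{1/q}\le C\left(\int_{0}^{1}\left\|\sum_{k=1}^{n} r_k(t)y_k\right\|^2dt\right)^{1/2}$ for all finite families $y_1,\dots,y_n\in Y$, where $r_k$ is the $k$-th Rademacher function; the smallest such constant is $C_q(Y)$. Kahane constants: for $0<p,s<\infty$, $\mathrm{K}_{p,s}>0$ denotes a constant such that $\left(\int_0^1\|\sum_{k=1}^n r_k(t)x_k\|^s dt\right)^{1/s}\le \mathrm{K}_{p,s}\left(\int_0^1\|\sum_{k=1}^n r_k(t)x_k\|^p dt\right)^{1/p}$ for every Banach space $X$ and all finite families $x_1,\dots,x_n\in X$. Put $\mathrm{A}_{q,r}(Y):=C_q(Y)\,\mathrm{K}_{r,2}$. Weak $\ell_1$-norm: $\|(x_i)_{i=1}^n\|_{w,1}:=\sup_{\|x'\|_{X'}\le 1}\sum_{i=1}^n|x'(x_i)|$. Multiple summing operators: for $1\le r<\infty$, $U\in\mathcal{L}(X_1,\dots,X_m;Y)$ is multiple $(r,1)$-summing if there is $C>0$ such that $$\left(\sum_{i_1,\dots,i_m=1}^n\left\|U\left(x_{i_1}^{(1)},\dots,x_{i_m}^{(m)}\right)\right\|_Y^r\right)^{1/r}\le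 C\prod_{k=1}^m\left\|\left(x_i^{(k)}\right)_{i=1}^n\right\|_{w,1}$$ for every $n$ and all vectors $x_i^{(k)}\in X_k$, $1\le i\le n$, $1\le k\le m$. The space of these operators is $\Pi^m_{(r,1)}(X_1,\dots,X_m;Y)$, normed by $\pi^m_{(r,1)}(U)$, the infimum of all such $C$. Subsets: for a finite set $D\subset\mathbb{N}$, $\mathcal{P}_k(D)$ is the set of subsets of $D$ of cardinality $k$, and $\mathcal{P}_k(m):=\mathcal{P}_k(\{1,\dots,m\})$. For $D\subset\{1,\dots,m\}$, $\widehat{D}:=\{1,\dots,m\}\setminus D$ and $X^D:=\prod_{k\in D}X_k$. Restricted maps: for a non-void proper subset $D$ of $\{1,\dots,m\}$ and $U\in\mathcal{L}(X_1,\dots,X_m;Y)$, $U^D:X^{\widehat{D}}\to\mathcal{L}(X^D;Y)$ is the $|\widehat{D}|$-linear map $x_{\widehat{D}}\mapsto U^D_{x_{\widehat{D}}}$, where $U^D_{x_{\widehat{D}}}(y_D)$ is the value of $U$ at the vector of $X_1\times\cdots\times X_m$ whose $\widehat{D}$-coordinates are those of $x_{\widehat{D}}$ and whose $D$-coordinates are those of $y_D$. Here $\mathcal{L}(X^D;Y)$ denotes bounded $|D|$-linear operators on the spaces $X_k$, $k\in D$, and $\Pi^{|D|}_{(r,1)}(X^D;Y)$ is the corresponding space of multiple $(r,1)$-summing operators. For a $|D|$-linear map $V=U^D_{x_{\widehat D}}$ on $X^D$ and a non-void proper subset $S\subset D$, $V^S:X^{D\setminus S}\to\mathcal{L}(X^S;Y)$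 is defined in the same way with $D$ in place of $\{1,\dots,m\}$. Expressions $\|U^D:X^{\widehat{D}}\to\Pi^{|D|}_{(r,1)}(X^D;Y)\|$ denote the norm of $U^D$ as a bounded multilinear operator into $\Pi^{|D|}_{(r,1)}(X^D;Y)$ (with norm $\pi^{|D|}_{(r,1)}$). $U$ is multiple $(r,1)$-summing in the coordinates of a non-void proper subset $D$ if $U^D$ takes its values in $\Pi^{|D|}_{(r,1)}(X^D;Y)$; for $D=\{1,\dots,m\}$ this means that $U$ is multiple $(r,1)$-summing. $U$ is $N$-separately $(r,1)$-summing if $U$ is multiple $(r,1)$-summing in every subset of $\{1,\dots,m\}$ of cardinality $N$. *)

(* Defs.v *)
From HB Require Import structures.
From mathcomp Require Import all_boot all_order all_algebra.
From mathcomp Require Import all_classical all_reals all_analysis.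
From mathcomp Require Import complex.

Set Implicit Arguments.
Unset Strict Implicit.
Unset Printing Implicit Defensive.

Import Order.TTheory GRing.Theory Num.Theory.
Import numFieldNormedType.Exports.

Local Open Scope classical_set_scope.
Local Open Scope ring_scope.

(* The scalar field is either R or the complex numbers R[i]. *)
Variant scalar_kind := RealScalars | ComplexScalars.

Definition scalars (R : realType) (k : scalar_kind) : numFieldType :=
  match k with
  | RealScalars => R
  | ComplexScalars => complex.complex R
  end.

Definition scalar_re (R : realType) (k : scalar_kind) : scalars R k -> R :=
  match k return scalars R k -> R with
  | RealScalars => fun a => a
  | ComplexScalars => fun a => complex.Re a
  end.

(* The library norm of a normed module over K takes its values in K. It is
   always a nonnegative real element of K, so that taking the real part only
   changes its type. *)
Definition rnorm (R : realType) (k : scalar_kind)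
    (V : normedModType (scalars R k)) (v : V) : R :=
  scalar_re `|v|.

(* X^D, as a family indexed by the elements of D. *)
Definition subfamily (T : Type) (I : finType) (X : I -> T) (D : {set I})
    (j : {i : I | i \in D}) : T :=
  X (val j).
Arguments subfamily {T I} X D j.

Definition multilinear (R : realType) (k : scalar_kind) (I : finType)
    (X : I -> completeNormedModType (scalars R k))
    (Y : completeNormedModType (scalars R k))
    (U : (forall i, X i) -> Y) : Prop :=
  forall (x : forall i, X i) (i : I) (a : scalars R k) (u v : X i),
    U (dfwith x i (a *: u + v)) = a *: U (dfwith x i u) + U (dfwith x i v).

Definition in_unit_balls (R : realType) (k : scalar_kind) (I : finType)
    (X : I -> completeNormedModType (scalars R k)) :
    set (forall i, X i) :=
  [set x | forall i, rnorm (x i) <= 1].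

Definition bounded_multilinear (R : realType) (k : scalar_kind) (I : finType)
    (X : I -> completeNormedModType (scalars R k))
    (Y : completeNormedModType (scalars R k))
    (U : (forall i, X i) -> Y) : Prop :=
  multilinear U /\
  exists C : R, forall x, in_unit_balls x -> rnorm (U x) <= C.

(* sign (sin (2^k pi t)), for k >= 1 *)
Definition rademacher (R : realType) (k : nat) (t : R) : int :=
  sgz (sin (2 ^+ k * pi * t)).

Definition rademacher_mean (R : realType) (k : scalar_kind)
    (Y : completeNormedModType (scalars R k)) (s : R)
    (n : nat) (y : 'I_n -> Y) : R :=
  (\int[lebesgue_measure]_(t in `[0%R, 1%R])
     rnorm (\sum_(j < n) y j *~ rademacher j.+1 t) `^ s) `^ s^-1.

Definition cotype_bound (R : realType) (k : scalar_kind)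
    (Y : completeNormedModType (scalars R k)) (q C : R) : Prop :=
  forall (n : nat) (y : 'I_n -> Y),
    (\sum_(j < n) rnorm (y j) `^ q) `^ q^-1 <= C * rademacher_mean 2 y.

Definition has_cotype (R : realType) (k : scalar_kind)
    (Y : completeNormedModType (scalars R k)) (q : R) : Prop :=
  exists2 C : R, 0 < C & cotype_bound Y q C.

Definition cotype_const (R : realType) (k : scalar_kind)
    (Y : completeNormedModType (scalars R k)) (q : R) : R :=
  inf [set C : R | 0 < C /\ cotype_bound Y q C].

Definition kahane_const (R : realType) (k : scalar_kind) (p s K : R) : Prop :=
  0 < K /\
  forall (X : completeNormedModType (scalars R k)) (n : nat) (x : 'I_n -> X),
    rademacher_mean s x <= K * rademacher_mean p x.

Definition dual_unit_ball (R : realType) (k : scalar_kind)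
    (V : normedModType (scalars R k)) :
    set {linear V -> (scalars R k)^o} :=
  [set f | forall v, rnorm v <= 1 -> rnorm (f v) <= 1].

Definition weak_l1_norm (R : realType) (k : scalar_kind)
    (V : normedModType (scalars R k)) (n : nat) (x : 'I_n -> V) : R :=
  sup [set \sum_(i < n) rnorm (f (x i)) | f in @dual_unit_ball R k V].

Definition summing_bound (R : realType) (k : scalar_kind) (I : finType)
    (X : I -> completeNormedModType (scalars R k))
    (Y : completeNormedModType (scalars R k)) (r : R)
    (U : (forall i, X i) -> Y) (C : R) : Prop :=
  forall (n : nat) (x : forall j : I, 'I_n -> X j),
    (\sum_(i : {ffun I -> 'I_n}) rnorm (U (fun j => x j (i j))) `^ r) `^ r^-1
    <= C * \prod_(j : I) weak_l1_norm (x j).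

(* Membership in Pi_(r,1)(X; Y). *)
Definition multiple_summing (R : realType) (k : scalar_kind) (I : finType)
    (X : I -> completeNormedModType (scalars R k))
    (Y : completeNormedModType (scalars R k)) (r : R)
    (U : (forall i, X i) -> Y) : Prop :=
  bounded_multilinear U /\ exists2 C : R, 0 < C & summing_bound r U C.

(* pi_(r,1)(U), equal to +oo when no constant exists. *)
Definition summing_norm (R : realType) (k : scalar_kind) (I : finType)
    (X : I -> completeNormedModType (scalars R k))
    (Y : completeNormedModType (scalars R k)) (r : R)
    (U : (forall i, X i) -> Y) : \bar R :=
  ereal_inf [set C%:E | C in [set C : R | 0 < C /\ summing_bound r U C]].

(* The point whose coordinates in D are those of y and whose other
   coordinates are those of x. *)
Definition glue_coords (R : realType) (k : scalar_kind) (I : finType)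
    (X : I -> completeNormedModType (scalars R k)) (D : {set I})
    (x : forall j, subfamily X (~: D) j) (y : forall j, subfamily X D j) :
    forall i, X i :=
  fun i =>
    match pselect (i \in D) with
    | left iD => y (exist _ i iD)
    | right iND => x (exist _ i (etrans (finset.in_setC i D) (introN idP iND)))
    end.

(* U^D : X^(~: D) -> L(X^D; Y). *)
Definition coord_restr (R : realType) (k : scalar_kind) (I : finType)
    (X : I -> completeNormedModType (scalars R k))
    (Y : completeNormedModType (scalars R k))
    (U : (forall i, X i) -> Y) (D : {set I})
    (x : forall j, subfamily X (~: D) j)
    (y : forall j, subfamily X D j) : Y :=
  U (glue_coords x y).

(* The norm of U^D : X^(~: D) -> Pi_(r,1)(X^D; Y), as a supremum over the
   product of the closed unit balls. *)
Definition coord_restr_norm (R : realType) (k : scalar_kind) (I : finType)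
    (X : I -> completeNormedModType (scalars R k))
    (Y : completeNormedModType (scalars R k)) (r : R)
    (U : (forall i, X i) -> Y) (D : {set I}) : \bar R :=
  ereal_sup [set summing_norm r (coord_restr U x)
            | x in @in_unit_balls R k _ (subfamily X (~: D))].

Definition multiple_summing_in (R : realType) (k : scalar_kind) (I : finType)
    (X : I -> completeNormedModType (scalars R k))
    (Y : completeNormedModType (scalars R k)) (r : R)
    (U : (forall i, X i) -> Y) (D : {set I}) : Prop :=
  if D == [set: I]%SET then multiple_summing r U
  else forall x : (forall j, subfamily X (~: D) j),
         multiple_summing r (coord_restr U x).

Definition separately_summing (R : realType) (k : scalar_kind) (I : finType)
    (X : I -> completeNormedModType (scalars R k))
    (Y : completeNormedModType (scalars R k)) (N : nat) (r : R)
    (U : (forall i, X i) -> Y) : Prop :=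
  forall D : {set I}, #|D| = N -> multiple_summing_in r U D.

(* r_N *)
Definition interp_exponent (R : realType) (q r : R) (n N : nat) : R :=
  q * r * N%:R / (n%:R * q + (N - n)%:R * r).

(* A_(q,r)(Y), for a given Kahane constant K = K_(r,2). *)
Definition A_const (R : realType) (k : scalar_kind)
    (Y : completeNormedModType (scalars R k)) (q K : R) : R :=
  cotype_const Y q * K.

(* Main.v *)
Require Import Defs.
From HB Require Import structures.
From mathcomp Require Import all_boot all_order all_algebra.
From mathcomp Require Import all_classical all_reals all_analysis.
From mathcomp Require Import complex measurable_realfun ring lra zify.

Set Implicit Arguments.
Unset Strict Implicit.
Unset Printing Implicit Defensive.

Import Order.TTheory GRing.Theory Num.Theory.
Import numFieldNormedType.Exports.

Local Open Scope classical_set_scope.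
Local Open Scope ring_scope.

(** Why the theorem holds. Fix one vector family x_j for each coordinate j in a
    set I with N elements (all coordinates, or those in D), put
    F z = | U z |, and for every set S of n coordinates consider the mixed
    norm of the array F (x_(i_1), ..., x_(i_N)) that is an l_r-sum over the
    indices in S outside and an l_q-sum over the other indices inside.

    Each of these mixed norms is bounded ([mixed_norm_le]). In a single coordinate, cotype
    q and Kahane's inequality bound the l_q-sum over the vectors x_t by A times
    the L_r-average of F at the random signed sums of the x_t
    ([coord_norm_cotype]). Since r <= q, Minkowski's inequality lets this
    replacement be made in all N - n coordinates outside S, at the price
    A ^ (N - n) ([coord_norms_trade]), and then lets the averages be
    exchanged with the l_r-sum over S ([coord_norms_exchange]). For fixed signs
    that l_r-sum is controlled by the summing norm of U^S at a point whose
    coordinates are signed sums, and their norms are at most the weak norms of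
    the families, by the Hahn-Banach theorem ([rnorm_signed_sum_le]).

    The mixed norms for the various S are then interpolated with equal weights
    1 / 'C(N, n). Minkowski's inequality brings the coordinates of all of them
    into one common order ([coord_norms_sort]); a coordinate then carries the
    exponent r in a proportion n / N of the sets S and the exponent q in the
    others ([sum_draws]), so that Hoelder's inequality, applied coordinate by
    coordinate ([coord_norms_hoelder]), produces the same exponent r_N, with
    1 / r_N = (n / N) / r + (1 - n / N) / q, in every coordinate
    ([summing_bound_interpolated]).

    Two qualitative facts make the right-hand sides finite. Kahane's constant
    exists for r >= 1, by a two-point hypercontractive estimate
    ([kahane_const_exists]). And a map that is multiple summing in the
    coordinates of S for each value of the remaining coordinates is so
    uniformly on their unit balls, by the uniform boundedness principle used in
    one coordinate after the other ([summing_bound_uniform]). *)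

(** * Scalars and real-valued norms *)

(** The inclusion of R in the scalar field. A norm computed in the scalar
    field is the image under it of the corresponding rnorm. *)
Definition embed (R : realType) (k : scalar_kind) : R -> scalars R k :=
  match k return R -> scalars R k with
  | RealScalars => id
  | ComplexScalars => fun a => real_complex R a
  end.
Arguments embed {R} k.

Section embed_theory.
Variables (R : realType) (k : scalar_kind).

Lemma embedD (a b : R) : embed k (a + b) = embed k a + embed k b.
Proof. by case: k => //=; rewrite rmorphD. Qed.

Lemma embedM (a b : R) : embed k (a * b) = embed k a * embed k b.
Proof. by case: k => //=; rewrite rmorphM. Qed.

Lemma embedN (a : R) : embed k (- a) = - embed k a.
Proof. by case: k => //=; rewrite rmorphN. Qed.

Lemma embed1 : embed k (1 : R) = 1.
Proof. by case: k => //=; rewrite rmorph1. Qed.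

Lemma embed0 : embed k (0 : R) = 0.
Proof. by case: k => //=; rewrite rmorph0. Qed.

Lemma embedK (a : R) : scalar_re (embed k a) = a.
Proof. by case: k. Qed.

Lemma embed_eq0 (a : R) : (embed k a == 0) = (a == 0).
Proof.
by apply/eqP/eqP => [/(congr1 (@scalar_re _ _))|->]; rewrite ?embedK ?embed0// -embed0 embedK.
Qed.

Lemma embed_le (a b : R) : (embed k a <= embed k b) = (a <= b).
Proof. by case: k => //=; rewrite lecR. Qed.

Lemma embed_lt (a b : R) : (embed k a < embed k b) = (a < b).
Proof. by case: k => //=; rewrite ltcR. Qed.

Lemma normr_embed (a : R) : `|embed k a| = embed k `|a|.
Proof. by case: k => //=; rewrite normc_def /= expr0n /= addr0 sqrtr_sqr. Qed.

(** Complex numbers are ordered by comparing real parts at equal imaginary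
    parts, so a nonnegative one is real. *)
Lemma scalar_reK (z : scalars R k) : 0 <= z -> embed k (scalar_re z) = z.
Proof.
case: k z => //= -[a b]; rewrite lecE /= => /andP[/eqP eb _].
by apply/eqP; rewrite eq_complex /= ?eqxx /= eb.
Qed.

End embed_theory.

Section rnorm_theory.
Variables (R : realType) (k : scalar_kind).
Variable V : normedModType (scalars R k).
Implicit Types v w : V.

Lemma norm_rnormE v : `|v| = embed k (rnorm v).
Proof. by rewrite scalar_reK. Qed.

Lemma rnorm_ge0 v : 0 <= rnorm v.
Proof. by rewrite -(embed_le k) -norm_rnormE embed0. Qed.

Lemma rnorm_embed v c : `|v| = embed k c -> rnorm v = c.
Proof. by rewrite /rnorm => ->; rewrite embedK. Qed.

Lemma rnorm0 : rnorm (0 : V) = 0.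
Proof. by apply: rnorm_embed; rewrite normr0 embed0. Qed.

Lemma rnorm_eq0 v : (rnorm v == 0) = (v == 0).
Proof. by rewrite -(embed_eq0 k) -norm_rnormE normr_eq0. Qed.

Lemma ler_rnormD v w : rnorm (v + w) <= rnorm v + rnorm w.
Proof. by rewrite -(embed_le k) embedD -!norm_rnormE ler_normD. Qed.

Lemma rnormN v : rnorm (- v) = rnorm v.
Proof. by rewrite /rnorm normrN. Qed.

Lemma rnormB v w : rnorm (v - w) = rnorm (w - v).
Proof. by rewrite -rnormN opprB. Qed.

Lemma rnormZ c v : rnorm (c *: v) = scalar_re `|c| * rnorm v.
Proof. by apply: rnorm_embed; rewrite normrZ embedM -norm_rnormE scalar_reK. Qed.

Lemma rnormZr (a : R) v : rnorm (embed k a *: v) = `|a| * rnorm v.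
Proof. by rewrite rnormZ normr_embed embedK. Qed.

Lemma ler_rnorm_sum (T : Type) (s : seq T) (P : pred T) (f : T -> V) :
  rnorm (\sum_(i <- s | P i) f i) <= \sum_(i <- s | P i) rnorm (f i).
Proof.
elim/big_ind2: _ => [|x x' y y' hx hy|//]; first by rewrite rnorm0.
by apply: le_trans (ler_rnormD _ _) _; apply: lerD.
Qed.

End rnorm_theory.

(** * Hoelder and Minkowski inequalities for finite sums *)

Section hoelder_finite.
Variable R : realType.

Lemma powR_sumr (T : finType) (P : pred T) (lam : T -> R) (A : R) : A != 0 ->
  \prod_(i | P i) A `^ lam i = A `^ (\sum_(i | P i) lam i).
Proof.
move=> A0; elim/big_rec2: _ => [|i x y _ ->]; first by rewrite powRr0.
by rewrite powRD// A0 implybT.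
Qed.

Lemma powR_prod (T : finType) (P : pred T) (f : T -> R) (a : R) :
  (forall i, P i -> 0 <= f i) ->
  (\prod_(i | P i) f i) `^ a = \prod_(i | P i) f i `^ a.
Proof.
move=> f0; suff [] : (\prod_(i | P i) f i) `^ a = \prod_(i | P i) f i `^ a /\
   0 <= \prod_(i | P i) f i by [].
elim/big_rec2: _ => [|i x y Pi [e y0]]; first by rewrite powR1.
by rewrite powRM// ?f0// e; split=> //; rewrite mulr_ge0 ?f0.
Qed.

Lemma powR_inv_gt0K (p a : R) : 0 < p -> 0 <= a -> (a `^ p) `^ p^-1 = a.
Proof. by move=> p0 a0; rewrite -powRrM divff ?gt_eqF// powRr1. Qed.

Lemma powR_invK (p a : R) : 0 < p -> 0 <= a -> (a `^ p^-1) `^ p = a.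
Proof. by move=> p0 a0; rewrite -powRrM mulVf ?gt_eqF// powRr1. Qed.

(** If A is the weighted mean, then c i / A is at most expR (c i / A - 1). In
    the product of the weighted powers of these bounds the exponents add up to
    0, because the weights add up to 1. *)
Lemma weighted_AGM (T : finType) (P : pred T) (lam c : T -> R) :
  (forall i, P i -> 0 < lam i) -> (forall i, P i -> 0 <= c i) ->
  \sum_(i | P i) lam i = 1 ->
  \prod_(i | P i) c i `^ lam i <= \sum_(i | P i) lam i * c i.
Proof.
move=> lam0 c0 lam1; set A := \sum_(i | P i) _.
have lc0 i : P i -> 0 <= lam i * c i by move=> Pi; rewrite mulr_ge0 ?c0// ltW ?lam0.
have A0 : 0 <= A by apply: sumr_ge0 => i /lc0.
have [A_eq0|An0] := eqVneq A 0.
  have [i Pi] : exists i, P i.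
    have [/existsP //|/existsPn noP] := boolP [exists i, P i].
    move/eqP: lam1; rewrite big_pred0 ?(eq_sym _ 1) ?oner_eq0// => i.
    exact/negbTE/noP.
  have /eqP := psumr_eq0P lc0 A_eq0 Pi; rewrite mulf_eq0 gt_eqF ?lam0//= => /eqP ci.
  by rewrite A_eq0 (bigD1 i)//= ci powR0 ?mul0r// gt_eqF ?lam0.
have Agt0 : 0 < A by rewrite lt_neqAle eq_sym An0.
have -> : A = \prod_(i | P i) A `^ lam i * \prod_(i | P i) expR (lam i * (c i / A - 1)).
  rewrite powR_sumr// lam1 powRr1// -expR_sum.
  under eq_bigr do rewrite mulrBr mulr1 mulrA.
  by rewrite sumrB lam1 -mulr_suml -/A divff// subrr expR0 mulr1.
rewrite -big_split/=; apply: ler_prod => i Pi; rewrite powR_ge0/=.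
rewrite (mulrC (lam i)) expRM -powRM ?expR_ge0//.
apply: ge0_ler_powR; rewrite ?nnegrE ?c0 ?mulr_ge0 ?expR_ge0//; first by rewrite ltW ?lam0.
rewrite mulrC -ler_pdivrMr//; apply: le_trans (expR_ge1Dx _).
by rewrite addrC subrK.
Qed.

(** Divide each factor by its sum and apply the inequality of means to each
    term. When one of the sums vanishes, every term on the left does. *)
Lemma hoelder_prod (S T : finType) (P : pred S) (lam : S -> R) (w : T -> R)
    (b : S -> T -> R) :
  (forall i, P i -> 0 < lam i) -> (forall t, 0 <= w t) ->
  (forall i t, P i -> 0 <= b i t) ->
  \sum_(i | P i) lam i = 1 ->
  \sum_t w t * \prod_(i | P i) b i t `^ lam i
    <= \prod_(i | P i) (\sum_t w t * b i t) `^ lam i.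
Proof.
move=> lam0 w0 b0 lam1; pose B i := \sum_t w t * b i t.
have wb0 i t : P i -> 0 <= w t * b i t by move=> Pi; rewrite mulr_ge0 ?b0.
have B0 i : P i -> 0 <= B i by move=> Pi; apply: sumr_ge0 => t _; exact: wb0.
have [/existsP[i /andP[Pi /eqP Bi0]]|/existsPn Bn0] := boolP [exists i, P i && (B i == 0)].
  rewrite big1 ?prodr_ge0// => [? _|t _]; first exact: powR_ge0.
  have /eqP : w t * b i t = 0 by exact: (psumr_eq0P (fun t _ => wb0 i t Pi) Bi0).
  rewrite mulf_eq0 => /orP[/eqP->|/eqP bit]; first by rewrite mul0r.
  by rewrite (bigD1 i)//= bit powR0 ?mul0r ?mulr0// gt_eqF ?lam0.
have Bgt0 i : P i -> 0 < B i.
  by move=> Pi; rewrite lt_neqAle B0// andbT eq_sym; have:= Bn0 i; rewrite Pi.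
pose D := \prod_(i | P i) B i `^ lam i.
have -> : \sum_t w t * \prod_(i | P i) b i t `^ lam i =
    D * \sum_t w t * \prod_(i | P i) (b i t / B i) `^ lam i.
  rewrite mulr_sumr; apply: eq_bigr => t _.
  rewrite mulrCA -big_split/=; congr (_ * _); apply: eq_bigr => i Pi.
  rewrite -powRM ?B0 ?divr_ge0 ?b0 ?B0// mulrC divfK// gt_eqF ?Bgt0//.
apply: ler_piMr; first by apply: prodr_ge0 => i _; exact: powR_ge0.
apply: (@le_trans _ _ (\sum_t w t * \sum_(i | P i) lam i * (b i t / B i))).
  apply: ler_sum => t _; apply: ler_wpM2l => //; apply: weighted_AGM => // i Pi.
  by rewrite divr_ge0 ?b0 ?B0.
rewrite -lam1 (eq_bigr (fun t => \sum_(i | P i) lam i / B i * (w t * b i t))) => [|t _].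
  rewrite exchange_big/=; apply: ler_sum => i Pi.
  by rewrite -mulr_sumr -/(B i) divfK// gt_eqF ?Bgt0.
by rewrite mulr_sumr; apply: eq_bigr => i _; ring.
Qed.

(** With c the inner combination, c ^ s = c * c ^ (s - 1) is linear in b
    through its first factor; Hoelder's inequality with exponents s and s / (s
    - 1) bounds each summand, and the common power of the left-hand side is
    divided out. *)
Lemma minkowski_finite (T1 T2 : finType) (w : T1 -> R) (v : T2 -> R)
    (b : T2 -> T1 -> R) (s : R) :
  1 <= s -> (forall t, 0 <= w t) -> (forall t, 0 <= v t) ->
  (forall i t, 0 <= b i t) ->
  (\sum_t w t * (\sum_i v i * b i t) `^ s) `^ s^-1
    <= \sum_i v i * (\sum_t w t * b i t `^ s) `^ s^-1.
Proof.
move=> s1 w0 v0 b0; have s0 : 0 < s by apply: lt_le_trans s1.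
pose c t := \sum_i v i * b i t.
have c0 t : 0 <= c t by apply: sumr_ge0 => i _; rewrite mulr_ge0.
have [->|sn1] := eqVneq s 1.
  rewrite invr1 powRr1; last by apply: sumr_ge0 => t _; rewrite mulr_ge0 ?powR_ge0.
  under eq_bigr do rewrite powRr1 ?c0// mulr_sumr.
  rewrite exchange_big/=; apply: ler_sum => i _.
  rewrite powRr1; last by apply: sumr_ge0 => t _; rewrite mulr_ge0 ?powR_ge0.
  by rewrite mulr_sumr; apply: ler_sum => t _; rewrite powRr1// mulrCA.
have sgt1 : 1 < s by rewrite lt_neqAle eq_sym sn1.
have sV1 : 0 < 1 - s^-1 by rewrite subr_gt0 invf_lt1.
pose A := \sum_t w t * c t `^ s; rewrite -/A.
have A0 : 0 <= A by apply: sumr_ge0 => t _; rewrite mulr_ge0 ?powR_ge0.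
have [->|An0] := eqVneq A 0.
  rewrite powR0 ?invr_neq0 ?gt_eqF//.
  by apply: sumr_ge0 => i _; rewrite mulr_ge0 ?powR_ge0.
have Agt0 : 0 < A by rewrite lt_neqAle eq_sym An0.
rewrite -(ler_pM2r (powR_gt0 (1 - s^-1) Agt0)) -powRD ?An0 ?implybT//.
rewrite addrC subrK powRr1// mulr_suml {1}/A.
have eA t : w t * c t `^ s = \sum_i v i * (w t * (b i t * c t `^ (s - 1))).
  rewrite -(mulr_powRB1 (c0 t) s0) {1}/c mulr_suml mulr_sumr.
  by apply: eq_bigr => i _; ring.
rewrite (eq_bigr _ (fun t _ => eA t)) exchange_big/=; apply: ler_sum => i _.
rewrite -mulr_sumr -mulrA ler_wpM2l//.
pose lam (x : bool) := if x then s^-1 else 1 - s^-1.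
pose bb (x : bool) t := if x then b i t `^ s else c t `^ s.
have lam_gt0 x : lam x > 0 by case: x; rewrite /lam ?invr_gt0.
have bb0 x t : 0 <= bb x t by case: x; exact: powR_ge0.
have lam1 : \sum_x lam x = 1 by rewrite big_bool/= addrC subrK.
have := hoelder_prod (fun x _ => lam_gt0 x) w0 (fun x t _ => bb0 x t) lam1.
rewrite [X in _ <= X -> _]big_bool/=; apply: le_trans.
apply: ler_sum => t _; rewrite ler_wpM2l// big_bool/=.
by rewrite powR_inv_gt0K// -powRrM mulrBr mulr1 divff ?gt_eqF.
Qed.

Lemma minkowski_sum (T : finType) (b c : T -> R) (s : R) : 1 <= s ->
  (forall t, 0 <= b t) -> (forall t, 0 <= c t) ->
  (\sum_t (b t + c t) `^ s) `^ s^-1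
    <= (\sum_t b t `^ s) `^ s^-1 + (\sum_t c t `^ s) `^ s^-1.
Proof.
move=> s1 b0 c0; pose f (x : bool) t := if x then b t else c t.
have f0 x t : 0 <= f x t by case: x.
have e1 (g : T -> R) : \sum_t 1 * g t = \sum_t g t by apply: eq_bigr => t _; rewrite mul1r.
have e2 (g : bool -> R) : \sum_x 1 * g x = g true + g false.
  by rewrite big_bool; congr (_ + _); exact: mul1r.
have := minkowski_finite s1 (fun=> ler01) (fun=> ler01) f0.
rewrite e2 !e1; apply: le_trans.
rewrite le_eqVlt; apply/orP; left; apply/eqP; apply: (congr1 (fun x => x `^ s^-1)).
by apply: eq_bigr => t _; rewrite e2.
Qed.

End hoelder_finite.

(** * Iterated norms over the coordinates *)

(** Finitely many points with one common weight. Weight 1 gives sums over the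
    vectors of a family, weight 2 ^ - M gives averages over signs; treating
    both alike makes one Minkowski inequality exchange any two of them. *)
Record sampling (R : realType) (Z : Type) := Sampling {
  sidx : finType; swt : R; swt_ge0 : 0 <= swt; spt : sidx -> Z }.

Section iterated_norms.
Variables (R : realType) (I : finType) (X : I -> Type).
Implicit Types (f g : (forall i, X i) -> R) (z : forall i, X i) (p q r : R).

(** The value remains a function of the whole point z, although it no longer
    depends on the coordinate j, so that norms in different coordinates
    compose without any change of index set. *)
Definition coord_norm j (a : sampling R (X j)) p f : (forall i, X i) -> R :=
  fun z => (\sum_(t : sidx a) swt a * f (dfwith z j (spt t)) `^ p) `^ p^-1.

Definition coord_norms (a : forall j, sampling R (X j)) (p : I -> R) (s : seq I) f :=
  foldr (fun j => coord_norm (a j) (p j)) f s.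

Lemma dfwithC (j k : I) z (u : X j) (v : X k) : j != k ->
  dfwith (dfwith z j u) k v = dfwith (dfwith z k v) j u.
Proof.
move=> jk; apply: functional_extensionality_dep => i.
have [<-|ki] := eqVneq k i.
  by rewrite dfwithin dfwithout// dfwithin.
rewrite (dfwithout _ _ ki); have [<-|ji] := eqVneq j i; first by rewrite !dfwithin.
by rewrite !dfwithout.
Qed.

Lemma eq_off_dfwith (s : seq I) j (u : X j) z z' :
  (forall i, i \notin j :: s -> z i = z' i) ->
  forall i, i \notin s -> dfwith z j u i = dfwith z' j u i.
Proof.
move=> zz' i si; have [<-|ji] := eqVneq j i; first by rewrite !dfwithin.
by rewrite !dfwithout// zz'// inE negb_or eq_sym ji.
Qed.

Lemma coord_norm_ge0 j (a : sampling R (X j)) p f z : 0 <= coord_norm a p f z.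
Proof. exact: powR_ge0. Qed.

Lemma coord_norms_ge0 a (p : I -> R) s f : (forall z, 0 <= f z) ->
  forall z, 0 <= coord_norms a p s f z.
Proof. by case: s => //= j s _ z; exact: coord_norm_ge0. Qed.

Lemma coord_norm_le j (a : sampling R (X j)) p f g : 0 < p ->
  (forall z, 0 <= f z) -> (forall z, f z <= g z) ->
  forall z, coord_norm a p f z <= coord_norm a p g z.
Proof.
move=> p0 f0 fg z.
have fgp t : f (dfwith z j (@spt _ _ a t)) `^ p <= g (dfwith z j (spt t)) `^ p.
  by apply: ge0_ler_powR; rewrite ?nnegrE ?f0 ?(ltW p0)//; apply: le_trans (f0 _) (fg _).
have wf (h : _ -> R) : 0 <= \sum_(t : sidx a) swt a * h (dfwith z j (spt t)) `^ p.
  by apply: sumr_ge0 => t _; rewrite mulr_ge0 ?powR_ge0 ?swt_ge0.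
apply: ge0_ler_powR; rewrite ?nnegrE ?wf ?invr_ge0 ?(ltW p0)//.
by apply: ler_sum => t _; rewrite ler_wpM2l ?swt_ge0.
Qed.

Lemma coord_norms_le a (p : I -> R) s f g : (forall j, 0 < p j) ->
  (forall z, 0 <= f z) -> (forall z, f z <= g z) ->
  forall z, coord_norms a p s f z <= coord_norms a p s g z.
Proof.
move=> p0 f0 fg; elim: s => [|j s IHs] z /=; first exact: fg.
apply: coord_norm_le; [exact: p0| |exact: IHs].
by move=> z'; exact: coord_norms_ge0.
Qed.

Lemma coord_normZ j (a : sampling R (X j)) p f (c : R) : 0 < p -> 0 <= c ->
  (forall z, 0 <= f z) ->
  coord_norm a p (fun z => c * f z) = (fun z => c * coord_norm a p f z).
Proof.
move=> p0 c0 f0; apply/funext => z; rewrite /coord_norm.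
have S0 : 0 <= \sum_(t : sidx a) swt a * f (dfwith z j (spt t)) `^ p.
  by apply: sumr_ge0 => t _; rewrite mulr_ge0 ?powR_ge0 ?swt_ge0.
rewrite -{2}(powR_inv_gt0K p0 c0) -powRM ?powR_ge0//; congr (_ `^ _).
by rewrite mulr_sumr; apply: eq_bigr => t _; rewrite powRM// mulrCA.
Qed.

Lemma coord_normsZ a (p : I -> R) s f (c : R) : (forall j, 0 < p j) -> 0 <= c ->
  (forall z, 0 <= f z) ->
  coord_norms a p s (fun z => c * f z) = (fun z => c * coord_norms a p s f z).
Proof.
move=> p0 c0 f0; elim: s => //= j s ->.
by rewrite coord_normZ// => z; exact: coord_norms_ge0.
Qed.

(** Minkowski's inequality for the exponent q / p: moving the larger exponent
    inside increases the norm. *)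
Lemma coord_norm_swap j k (a : sampling R (X j)) (b : sampling R (X k)) p q f :
  j != k -> 0 < p -> p <= q -> (forall z, 0 <= f z) ->
  forall z, coord_norm b q (coord_norm a p f) z <= coord_norm a p (coord_norm b q f) z.
Proof.
move=> jk p0 pq f0 z; have q0 : 0 < q by apply: lt_le_trans pq.
have pV0 : 0 <= p^-1 by rewrite invr_ge0 ltW.
pose B t u := f (dfwith (dfwith z k (@spt _ _ b u)) j (@spt _ _ a t)) `^ p.
have B0 t u : 0 <= B t u by exact: powR_ge0.
have qp1 : 1 <= q / p by rewrite ler_pdivlMr// mul1r.
have sB0 u : 0 <= \sum_t swt a * B t u.
  by apply: sumr_ge0 => t _; rewrite mulr_ge0 ?swt_ge0.
have -> : coord_norm b q (coord_norm a p f) z =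
    ((\sum_u swt b * (\sum_t swt a * B t u) `^ (q / p)) `^ (q / p)^-1) `^ p^-1.
  have e : (q / p)^-1 * p^-1 = q^-1 by field; rewrite !gt_eqF.
  rewrite -powRrM e; apply: (congr1 (fun s => s `^ q^-1)).
  apply: eq_bigr => u _; congr (_ * _); rewrite [q / p]mulrC powRrM.
  by [].
rewrite /coord_norm; apply: ge0_ler_powR; rewrite ?nnegrE ?powR_ge0//.
  by apply: sumr_ge0 => t _; rewrite mulr_ge0 ?powR_ge0 ?swt_ge0.
have := @minkowski_finite R _ _ (fun=> swt b) (fun=> swt a) B (q / p) qp1
  (fun=> swt_ge0 _) (fun=> swt_ge0 _) B0.
move/le_trans; apply; apply: ler_sum => t _; rewrite ler_wpM2l ?swt_ge0//.
have -> : (q / p)^-1 = q^-1 * p by rewrite invf_div mulrC.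
rewrite powRrM; set u1 := \sum_u _; set u2 := \sum_u _; suff -> : u1 = u2 by [].
apply: eq_bigr => u _; rewrite /B -powRrM [p * _]mulrC divfK ?gt_eqF// dfwithC//.
by rewrite eq_sym.
Qed.

Lemma coord_norms_in k (b : sampling R (X k)) a (p : I -> R) q s f :
  k \notin s -> (forall j, 0 < p j) -> (forall j, p j <= q) -> (forall z, 0 <= f z) ->
  forall z, coord_norm b q (coord_norms a p s f) z
            <= coord_norms a p s (coord_norm b q f) z.
Proof.
move=> + p0 pq f0; elim: s => //= j s IHs; rewrite inE negb_or => /andP[kj ks] z.
apply: le_trans (coord_norm_swap (a j) b _ (p0 j) (pq j) (coord_norms_ge0 a p s f0) z) _.
  by rewrite eq_sym.
apply: coord_norm_le => // z'; first exact: coord_norm_ge0.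
exact: IHs.
Qed.

Lemma coord_norms_out k (b : sampling R (X k)) a p (q : I -> R) s f :
  k \notin s -> 0 < p -> (forall j, p <= q j) -> (forall z, 0 <= f z) ->
  forall z, coord_norms a q s (coord_norm b p f) z
            <= coord_norm b p (coord_norms a q s f) z.
Proof.
move=> + p0 pq f0; elim: s => //= j s IHs; rewrite inE negb_or => /andP[kj ks] z.
have q0 i : 0 < q i by apply: lt_le_trans (pq i).
apply: le_trans (coord_norm_swap b (a j) kj p0 (pq j) (coord_norms_ge0 a q s f0) z).
apply: coord_norm_le => // z'; last exact: IHs.
by apply: coord_norms_ge0 => ?; exact: coord_norm_ge0.
Qed.

(** Insertion sort by [coord_norms_in]: the larger exponent q is pushed
    inside, past the coordinates with exponent r, and each such move increases
    the norm. *)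
Lemma coord_norms_sort a (P : pred I) (r q : R) s f : uniq s -> 0 < r -> r <= q ->
  (forall z, 0 <= f z) ->
  forall z, coord_norms a (fun j => if P j then r else q) s f z
    <= coord_norms a (fun=> r) [seq j <- s | P j]
         (coord_norms a (fun=> q) [seq j <- s | ~~ P j] f) z.
Proof.
move=> + r0 rq f0; have q0 : 0 < q by apply: lt_le_trans rq.
have pos j : 0 < (if P j then r else q) by case: ifP.
elim: s => //= j s IHs /andP[js us] z; have {}IHs := IHs us.
case: ifPn => Pj /=; first by apply: coord_norm_le => // z'; exact: coord_norms_ge0.
apply: le_trans (coord_norm_le (a j) q0 _ IHs z) _.
  exact: coord_norms_ge0.
apply: coord_norms_in; [|by move=> _|by move=> _|exact: coord_norms_ge0].
by rewrite mem_filter (negbTE js) andbF.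
Qed.

(** The estimate in a single coordinate can be repeated because the r-norms
    already obtained move outside the q-norm still to be replaced, by
    Minkowski's inequality. *)
Lemma coord_norms_trade a b (q r A : R) s f : uniq s -> 0 < r -> r <= q -> 0 <= A ->
  (forall z, 0 <= f z) ->
  (forall j z, j \in s -> coord_norm (a j) q f z <= A * coord_norm (b j) r f z) ->
  forall z, coord_norms a (fun=> q) s f z
            <= A ^+ size s * coord_norms b (fun=> r) s f z.
Proof.
move=> + r0 rq A0 f0; have q0 : 0 < q by apply: lt_le_trans rq.
elim: s => [_ _ z|j s IHs /= /andP[js us] ab z]; first by rewrite expr0 mul1r.
have {}IHs := IHs us (fun i z si => ab i z (@mem_behead _ (j :: s) _ si)).
have As0 n : 0 <= A ^+ n by rewrite exprn_ge0.
have f0' := coord_norms_ge0 b (fun=> r) s f0.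
have fj0 z' : 0 <= coord_norm (b j) r f z' by exact: coord_norm_ge0.
apply: le_trans (coord_norm_le (a j) q0 (coord_norms_ge0 _ _ _ f0) IHs z) _.
rewrite coord_normZ// exprSr -mulrA ler_wpM2l//.
apply: le_trans (coord_norms_in (a j) b js _ _ f0 z) _ => //.
apply: le_trans (coord_norms_le b s _ _ (fun z => ab j z (mem_head j s)) z) _ => //.
  by move=> z'; exact: coord_norm_ge0.
rewrite coord_normsZ// ler_wpM2l//.
by apply: coord_norms_out.
Qed.

(** For equal exponents Minkowski's inequality holds in both directions, so
    that the norms commute. *)
Lemma coord_norms_exchange a b (r : R) s1 s2 f : 0 < r ->
  (forall j, j \in s2 -> j \notin s1) -> (forall z, 0 <= f z) ->
  forall z, coord_norms a (fun=> r) s1 (coord_norms b (fun=> r) s2 f) z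
            <= coord_norms b (fun=> r) s2 (coord_norms a (fun=> r) s1 f) z.
Proof.
move=> r0 s12 f0; elim: s2 s12 => //= j s IHs s12 z.
have js1 : j \notin s1 by apply: s12; exact: mem_head.
apply: le_trans (coord_norms_out (b j) a js1 r0 (fun=> lexx r) _ z) _.
  exact: coord_norms_ge0.
apply: coord_norm_le => // z'; first by do 2!apply: coord_norms_ge0.
by apply: IHs => i si; apply: s12; rewrite inE si orbT.
Qed.

(** Averages do not exceed upper bounds. The predicate Q records what is known
    of the sampled points, so that f has to be bounded only where all the
    averaged coordinates satisfy it. *)
Lemma coord_norms_le_bound a (Q : forall j, X j -> Prop) (r C : R) s f z :
  0 < r -> 0 <= C -> (forall z, 0 <= f z) ->
  (forall j, j \in s -> swt (a j) * #|sidx (a j)|%:R <= 1) ->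
  (forall j t, j \in s -> Q j (@spt _ _ (a j) t)) ->
  (forall z', (forall j, j \notin s -> z' j = z j) ->
     (forall j, j \in s -> Q j (z' j)) -> f z' <= C) ->
  coord_norms a (fun=> r) s f z <= C.
Proof.
move=> r0 C0 f0; elim: s z => [z _ _ fC|j s IHs z mass aQ fC] /=; first exact: fC.
have rV0 : 0 <= r^-1 by rewrite invr_ge0 ltW.
rewrite -[leRHS](powR_inv_gt0K r0)//; apply: ge0_ler_powR; rewrite ?nnegrE ?powR_ge0//.
  by apply: sumr_ge0 => t _; rewrite mulr_ge0 ?powR_ge0 ?swt_ge0.
apply: (@le_trans _ _ (\sum_(t : sidx (a j)) swt (a j) * C `^ r)).
  apply: ler_sum => t _; rewrite ler_wpM2l ?swt_ge0//.
  apply: ge0_ler_powR; rewrite ?nnegrE ?(ltW r0)//; first exact: coord_norms_ge0.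
  apply: IHs => [i si|i u si|z' z'z Qz'].
  - by apply: mass; rewrite inE si orbT.
  - by apply: aQ; rewrite inE si orbT.
  apply: fC => i; rewrite inE.
    rewrite negb_or => /andP[ij si]; rewrite z'z// dfwithout//.
    by rewrite eq_sym.
  have [si _|si] := boolP (i \in s); first exact: Qz'.
  rewrite orbF => /eqP ij; rewrite z'z//; subst i; rewrite dfwithin.
  by apply: aQ; exact: mem_head.
rewrite sumr_const -mulr_natl mulrA [_ * swt _]mulrC.
by rewrite ler_piMl ?powR_ge0// mass// mem_head.
Qed.

Lemma coord_norms_eq_off a (p : I -> R) s f z z' : (forall i, i \notin s -> z i = z' i) ->
  coord_norms a p s f z = coord_norms a p s f z'.
Proof.
elim: s z z' => [|j s IHs] z z' zz' /=.
  by congr (f _); apply: functional_extensionality_dep => i; exact: zz'.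
congr (_ `^ _); apply: eq_bigr => t _; congr (_ * _ `^ _).
by apply: IHs; exact: eq_off_dfwith.
Qed.

(** Hoelder's inequality in one coordinate after the other. The exponents may
    differ from coordinate to coordinate, but their weighted harmonic mean
    must be the same everywhere, for the left-hand side to have a single
    exponent. *)
Lemma coord_norms_hoelder (S : finType) (P : pred S)
    (a : forall j, sampling R (X j)) (rho : R) (p : S -> I -> R)
    (theta : S -> R) s (f : S -> (forall i, X i) -> R) :
  0 < rho -> (forall i, P i -> 0 < theta i) -> (forall i j, P i -> 0 < p i j) ->
  (forall j, \sum_(i | P i) theta i / p i j = rho^-1) ->
  (forall i z, P i -> 0 <= f i z) ->
  forall z, coord_norms a (fun=> rho) s (fun z => \prod_(i | P i) f i z `^ theta i) z
    <= \prod_(i | P i) coord_norms a (p i) s (f i) z `^ theta i.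
Proof.
move=> rho0 th0 p0 sumth f0; elim: s => //= j s IHs z.
pose g i z := coord_norms a (p i) s (f i) z.
have g0 i z' : P i -> 0 <= g i z' by move=> Pi; apply: coord_norms_ge0 => ?; exact: f0.
apply: (@le_trans _ _ (coord_norm (a j) rho (fun z => \prod_(i | P i) g i z `^ theta i) z)).
  apply: coord_norm_le => // z'; apply: coord_norms_ge0 => ?; apply: prodr_ge0 => ? _.
  exact: powR_ge0.
pose lam i := rho * theta i / p i j.
have lam0 i : P i -> 0 < lam i by move=> Pi; rewrite divr_gt0 ?mulr_gt0 ?th0 ?p0.
have lam1 : \sum_(i | P i) lam i = 1.
  rewrite /lam; under eq_bigr do rewrite -mulrA.
  by rewrite -mulr_sumr sumth divff ?gt_eqF.
pose b i t := g i (dfwith z j (@spt _ _ (a j) t)) `^ p i j.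
have b0 i t : P i -> 0 <= b i t by move=> _; exact: powR_ge0.
have := hoelder_prod lam0 (fun=> swt_ge0 (a j)) b0 lam1.
have -> : \sum_t swt (a j) * \prod_(i | P i) b i t `^ lam i =
  \sum_t swt (a j) * (\prod_(i | P i) g i (dfwith z j (@spt _ _ (a j) t)) `^ theta i) `^ rho.
  apply: eq_bigr => t _; congr (_ * _); rewrite powR_prod => [|i _]; last exact: powR_ge0.
  apply: eq_bigr => i Pi; rewrite -!powRrM; congr (_ `^ _).
  by rewrite /lam mulrC divfK ?gt_eqF ?p0// mulrC.
have rhoV0 : 0 <= rho^-1 by rewrite invr_ge0 ltW.
move=> h; apply: le_trans (ge0_ler_powR rhoV0 _ _ h) _.
- by rewrite nnegrE; apply: sumr_ge0 => t _; rewrite mulr_ge0 ?powR_ge0 ?swt_ge0.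
- by rewrite nnegrE; apply: prodr_ge0 => t _; rewrite powR_ge0.
rewrite powR_prod => [|i _]; last exact: powR_ge0.
apply: ler_prod => i Pi; rewrite powR_ge0/= -powRrM le_eqVlt; apply/orP; left; apply/eqP.
rewrite /coord_norm -powRrM; congr (_ `^ _).
by rewrite /lam; field; rewrite !gt_eqF ?p0.
Qed.

End iterated_norms.

Section iterated_sum.
Variables (R : realType) (I : finType) (X : I -> Type) (M : nat).
Variable x : forall j, 'I_M -> X j.

Definition samples j : sampling R (X j) := Sampling ler01 (x j).

Definition select (D : {pred I}) (z : forall i, X i) (h : {ffun I -> 'I_M}) i : X i :=
  if i \in D then x i (h i) else z i.

(** Multi-indices extending h are classified by their value at the head
    coordinate j, which is the sum that the outermost norm forms. *)
Lemma coord_norms_sum (p : R) (D : {pred I}) s f z h : 0 < p -> uniq s -> {subset s <= D} ->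
  (forall z, 0 <= f z) ->
  coord_norms samples (fun=> p) s f (select D z h) `^ p =
  \sum_(h' in family (fun j => if j \in s then predT else pred1 (h j)))
     f (select D z h') `^ p.
Proof.
move=> p0 + + f0; elim: s h => [|j s IHs] h /= us sD.
  rewrite (big_pred1 h)// => h'; apply/familyP/eqP => [hh'|-> i]; last by rewrite !inE.
  by apply/ffunP => i; apply/eqP; have := hh' i.
case/andP: us => js us.
rewrite powR_invK//; last by apply: sumr_ge0 => t _; rewrite mul1r powR_ge0.
pose upd t := [ffun i => if i == j then t else h i].
have jD : j \in D by apply: sD; exact: mem_head.
have updE t : dfwith (select D z h) j (x j t) = select D z (upd t).
  apply: functional_extensionality_dep => i; rewrite /select ffunE.
  have [<-|ji] := eqVneq j i; first by rewrite dfwithin jD ?eqxx.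
  by rewrite dfwithout// eq_sym (negbTE ji).
rewrite (partition_big (fun h' : {ffun I -> 'I_M} => h' j) predT)//=.
apply: eq_bigr => t _; rewrite mul1r updE IHs//; last first.
  by move=> i si; apply: sD; rewrite inE si orbT.
apply: eq_bigl => h'; apply/familyP/andP => [hh'|[/familyP hh' /eqP <-] i].
  split; last by have := hh' j; rewrite (negbTE js) ffunE eqxx inE.
  apply/familyP => i; have := hh' i; rewrite inE ffunE.
  by have [->|//] := eqVneq i j; rewrite (negbTE js).
have := hh' i; rewrite inE ffunE; case: eqVneq => [->|//] _.
by rewrite (negbTE js) inE.
Qed.

End iterated_sum.

(** * Rademacher means as averages over dyadic intervals *)

Section rademacher_average.
Variable R : realType.

Lemma sgz_sin_pi (a : nat) (u : R) : a%:R < u < a.+1%:R ->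
  sgz (sin (pi * u)) = (-1) ^+ a.
Proof.
elim: a u => [|a IHa] u; rewrite ?mulr1n => /andP[au ua].
  rewrite expr0 gtr0_sgz// sin_gt0_pi// mulr_gt0 ?pi_gt0//=.
  by rewrite -[ltRHS]mulr1 ltr_pM2l ?pi_gt0.
rewrite -(subrK 1 u) mulrDr mulr1 sinDpi sgzN IHa ?exprS ?mulN1r//.
by rewrite ltrBrDr ltrBlDr !natr1 au.
Qed.

(** The value of the (j+1)-st Rademacher function on the k-th open dyadic
    interval of length 2 ^ - n: the parity of the quotient is the digit of k
    that belongs to the scale 2 ^ - j.+1. *)
Definition dyadic_sign (n j k : nat) : int := (-1) ^+ (k %/ 2 ^ (n.-1 - j)).

Lemma rademacher_dyadic (n j k : nat) (t : R) : (j < n)%N ->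
  k%:R * 2 ^- n < t < k.+1%:R * 2 ^- n ->
  rademacher j.+1 t = dyadic_sign n j k.
Proof.
move=> jn /andP[kt tk]; rewrite /rademacher [2 ^+ _ * _]mulrC -mulrA.
apply: sgz_sin_pi; set e := (n.-1 - j)%N.
have ne : n = (j.+1 + e)%N by rewrite /e; lia.
have p2 m : 0 < 2 ^+ m :> R by rewrite exprn_gt0.
have bound : 2 ^+ n = 2 ^+ j.+1 * 2 ^+ e :> R by rewrite ne exprD.
rewrite ltr_pdivrMr// mulrC in kt; rewrite ltr_pdivlMr// mulrC in tk.
rewrite -(ltr_pM2r (p2 e)) -[X in _ && X](ltr_pM2r (p2 e)).
have -> : 2 ^+ j.+1 * t * 2 ^+ e = 2 ^+ n * t by rewrite bound mulrAC.
rewrite -natrX -!natrM; apply/andP; split.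
  by apply: le_lt_trans kt; rewrite ler_nat leq_divM.
by apply: lt_le_trans tk _; rewrite ler_nat ltn_ceil// expn_gt0.
Qed.

(** The function is prescribed only inside the intervals, their end points
    being negligible; as it is nonnegative, its integral is additive without a
    discussion of integrability. *)
Lemma integral_step (h : R -> R) (d : R) (c : nat -> R) (K : nat) : 0 < d ->
  (forall t, 0 <= h t) ->
  (forall k t, (k < K)%N -> k%:R * d < t < k.+1%:R * d -> h t = c k) ->
  measurable_fun `[0, K%:R * d[ h /\
  (\int[lebesgue_measure]_(t in `[0%R, (K%:R * d)%R[) (h t)%:E
   = (\sum_(k < K) d * c k)%R%:E)%E.
Proof.
move=> d0 h0; elim: K => [|K IHK] hc.
  rewrite mul0r set_itvco0 big_ord0 integral_set0; split=> //.
  exact: measurable_fun_set0.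
have [mK intK] := IHK (fun k t kK => hc k t (ltnW kK)).
have Kd0 : 0 <= K%:R * d by rewrite mulr_ge0// ltW.
have KSd : K%:R * d < K.+1%:R * d by rewrite ltr_pM2r// ltr_nat.
have hK : {in `]K%:R * d, (K.+1%:R * d)[, h =1 cst (c K)}.
  by move=> t; rewrite in_itv/=; exact: hc.
have mo : measurable_fun `]K%:R * d, (K.+1%:R * d)[ h.
  apply: (@eq_measurable_fun _ _ _ _ _ (cst (c K))) => // t.
  by rewrite inE/= => /hK ->.
have mc : measurable_fun `[K%:R * d, (K.+1%:R * d)[ h.
  exact/measurable_fun_itv_obnd_cbndP.
have eU : `[0, K.+1%:R * d[%classic = `[0, K%:R * d[ `|` `[K%:R * d, (K.+1%:R * d)[.
  by rewrite -itv_bndbnd_setU ?bnd_simp// ltW.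
rewrite eU; split; first by apply/measurable_funU.
rewrite ge0_integral_setU//=.
- rewrite intK integral_itv_bndoo; last exact/measurable_EFinP.
  rewrite (eq_integral (cst (c K)%:E)); last first.
    by move=> t; rewrite inE/= => /hK ->.
  rewrite integral_cst//= lebesgue_measure_itv/= lte_fin KSd -EFinD -mulrBl.
  by rewrite -natrB// subSnn mul1r big_ord_recr/= [c K * d]mulrC.
- by apply/measurable_EFinP/measurable_funU.
- by move=> t _; rewrite lee_fin.
- apply/disj_set2P; rewrite -subset0 => t /=; rewrite !in_itv/= => -[/andP[_ tK] /andP[Kt _]].
  by move: (lt_le_trans tK Kt); rewrite ltxx.
Qed.

Lemma Rintegral_rademacher (n : nat) (f : ('I_n -> int) -> R) :
  (forall s, 0 <= f s) ->
  (\int[lebesgue_measure]_(t in `[0%R, 1%R]) f (fun j => rademacher j.+1 t))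
  = \sum_(k < 2 ^ n) 2 ^- n * f (fun j : 'I_n => dyadic_sign n j k).
Proof.
move=> f0; pose h (t : R) := f (fun j : 'I_n => rademacher j.+1 t).
have d0 : 0 < 2 ^- n :> R by rewrite invr_gt0 exprn_gt0.
have := @integral_step h (2 ^- n) (fun k => f (fun j : 'I_n => dyadic_sign n j k)) (2 ^ n) d0
  (fun t => f0 _).
rewrite natrX divff ?expf_neq0// => -[k t k2 tk|mh inth].
  by congr f; apply/funext => j; exact: rademacher_dyadic.
rewrite /Rintegral -integral_itv_bndo_bndc; last exact/measurable_EFinP.
by rewrite inth.
Qed.

End rademacher_average.

Section rademacher_mean.
Variables (R : realType) (k : scalar_kind) (Y : completeNormedModType (scalars R k)).

(** Through this identity cotype and Kahane's inequality become statements
    about finite averages. *)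
Lemma rademacher_meanE (s : R) (n : nat) (y : 'I_n -> Y) :
  rademacher_mean s y = (\sum_(i < 2 ^ n) 2 ^- n *
    rnorm (\sum_(j < n) y j *~ dyadic_sign n j i) `^ s) `^ s^-1.
Proof.
rewrite /rademacher_mean; congr (_ `^ _).
exact: (@Rintegral_rademacher R n (fun e => rnorm (\sum_(j < n) y j *~ e j) `^ s)
  (fun=> powR_ge0 _ _)).
Qed.

End rademacher_mean.

(** * Kahane's inequality *)

Section sign_average.
Variables (R : realType) (V : zmodType).

(** The average of g at x +- y 0 +- ... +- y n.-1. The last sign is split off
    first, so that an induction on n meets only two points at a time. *)
Fixpoint sign_average (n : nat) (y : nat -> V) (g : V -> R) (x : V) : R :=
  if n is n'.+1 then
    (sign_average n' y g (x + y n') + sign_average n' y g (x - y n')) / 2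
  else g x.

Lemma big_ord_double (K : nat) (F : nat -> R) :
  \sum_(i < K.*2) F i = \sum_(i < K) (F i.*2 + F i.*2.+1).
Proof.
elim: K => [|K IHK]; first by rewrite !big_ord0.
by rewrite doubleS !big_ord_recr/= IHK addrA.
Qed.

Lemma dyadic_sign_double (n j i : nat) (b : bool) : (j < n)%N ->
  dyadic_sign n.+1 j (b + i.*2) = dyadic_sign n j i.
Proof.
move=> jn; rewrite /dyadic_sign/=.
have -> : (n - j = (n.-1 - j).+1)%N by lia.
by rewrite expnS divnMA divn2 half_bit_double.
Qed.

Lemma dyadic_sign_last (n i : nat) : dyadic_sign n.+1 n i = (-1) ^+ odd i.
Proof. by rewrite /dyadic_sign/= subnn divn1 signr_odd. Qed.

(** The parity of an index in 'I_(2 ^ n.+1) is its sign of finest scale, and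
    halving the index leaves the other signs unchanged. *)
Lemma dyadic_averageE (n : nat) (y : nat -> V) (g : V -> R) (x : V) :
  \sum_(i < 2 ^ n) 2 ^- n * g (x + \sum_(j < n) y j *~ dyadic_sign n j i)
  = sign_average n y g x.
Proof.
elim: n x => [|n IHn] x.
  by rewrite expn0 big_ord1 big_ord0 addr0 expr0 invr1 mul1r.
rewrite /= -!IHn -big_split/= mulr_suml expnS mul2n.
rewrite (@big_ord_double (2 ^ n) (fun i => 2 ^- n.+1 *
  g (x + \sum_(j < n.+1) y j *~ dyadic_sign n.+1 j i))).
apply: eq_bigr => i _; rewrite -!mulrDr exprS invfM mulrAC [2^-1 * _]mulrC.
rewrite !big_ord_recr/= !dyadic_sign_last/= odd_double/= expr0 expr1 mulr1z mulrN1z.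
have e (b : bool) : \sum_(j < n) y j *~ dyadic_sign n.+1 j (b + i.*2) =
    \sum_(j < n) y j *~ dyadic_sign n j i.
  by apply: eq_bigr => j _; rewrite dyadic_sign_double.
have := e false; have := e true; rewrite add0n add1n => -> ->.
rewrite [x + y n + _]addrAC [x - y n + _]addrAC !addrA.
by rewrite mulrAC [2 ^- n * _]mulrC.
Qed.

End sign_average.

Section kahane.
Variables (R : realType) (k : scalar_kind) (V : normedModType (scalars R k)).
Implicit Types (x u : V) (y : nat -> V) (A B : V -> R).

Lemma sign_average_ge0 n y A : (forall x, 0 <= A x) -> forall x, 0 <= sign_average n y A x.
Proof. by move=> A0; elim: n => //= n IHn x; rewrite divr_ge0 ?addr_ge0. Qed.

Lemma sign_average_le n y A B : (forall x, A x <= B x) ->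
  forall x, sign_average n y A x <= sign_average n y B x.
Proof. by move=> AB; elim: n => //= n IHn x; rewrite ler_pM2r// lerD. Qed.

Lemma sign_averageD n y A B (a b : R) x :
  sign_average n y (fun x => a * A x + b * B x) x =
  a * sign_average n y A x + b * sign_average n y B x.
Proof. by elim: n x => //= n IHn x; rewrite !IHn; field. Qed.

(** For A the square of the norm this is the two-point hypercontractive
    inequality from L_2 to L_4 with contraction 1/2. It is isolated as a
    property of A because it passes to averages of translates of A. *)
Definition two_point_contraction A :=
  (forall x, 0 <= A x) /\
  forall x u, (A (x + embed k 2^-1 *: u) ^+ 2 + A (x - embed k 2^-1 *: u) ^+ 2) / 2
    <= ((A (x + u) + A (x - u)) / 2) ^+ 2.

Lemma rnorm_half_le x u :
  rnorm (x + embed k 2^-1 *: u) <= (3 * rnorm (x + u) + rnorm (x - u)) / 4.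
Proof.
have h4 : 4^-1 + 4^-1 = 2^-1 :> R by field.
have h1 : 3 / 4 + 4^-1 = 1 :> R by field.
have h2 : 3 / 4 - 4^-1 = 2^-1 :> R by field.
have -> : x + embed k 2^-1 *: u =
    embed k (3 / 4) *: (x + u) + embed k 4^-1 *: (x - u).
  rewrite scalerBr scalerDr addrACA -scalerDl -scalerBl.
  by rewrite -embedD -embedN -embedD h1 h2 embed1 scale1r.
apply: le_trans (ler_rnormD _ _) _; rewrite !rnormZr !ger0_norm//.
by lra.
Qed.

(** Let a and b be the half sum and the half difference of the norms of x + u
    and x - u. By convexity the norms of x +- u / 2 are at most a +- b / 2,
    and the mean of their fourth powers, a ^ 4 + 3/2 a ^ 2 b ^ 2 + b ^ 4 / 16,
    is at most (a ^ 2 + b ^ 2) ^ 2. *)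
Lemma two_point_rnorm : two_point_contraction (fun x => rnorm x ^+ 2).
Proof.
split=> [x|x u]; first by rewrite exprn_ge0 ?rnorm_ge0.
have h1 := rnorm_half_le x u; have := rnorm_half_le x (- u).
rewrite scalerN opprK [X in (X + _) / 4]mulrC => h2.
have := rnorm_ge0 (x + u); have := rnorm_ge0 (x - u).
move: h1 h2; set P := rnorm (x + _); set Q := rnorm (x - _ *: _).
have := rnorm_ge0 (x + embed k 2^-1 *: u); have := rnorm_ge0 (x - embed k 2^-1 *: u).
rewrite -/P -/Q; move: (rnorm (x + u)) (rnorm (x - u)) => X Z.
move=> Q0 P0 hP hQ Z0 X0.
set p := (3 * X + Z) / 4; set q := (3 * Z + X) / 4.
have P4 : (P ^+ 2) ^+ 2 <= (p ^+ 2) ^+ 2 by rewrite -!exprM lerXn2r ?nnegrE// /p; lra.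
have Q4 : (Q ^+ 2) ^+ 2 <= (q ^+ 2) ^+ 2.
  by rewrite -!exprM lerXn2r ?nnegrE// /q; lra.
apply: (@le_trans _ _ (((p ^+ 2) ^+ 2 + (q ^+ 2) ^+ 2) / 2)); first by lra.
(* the difference is a ^ 2 b ^ 2 / 2 + 15/16 b ^ 4 *)
rewrite -subr_ge0 [X in 0 <= X](_ : _ =
  (X ^+ 2 - Z ^+ 2) ^+ 2 / 32 + 15 / 256 * (X - Z) ^+ 4).
  have := sqr_ge0 (X ^+ 2 - Z ^+ 2); have : 0 <= (X - Z) ^+ 4 by rewrite exprn_even_ge0.
  by move: (_ ^+ 4) (_ ^+ 2) => a b; lra.
by rewrite /p /q; field.
Qed.

Lemma minkowski_plane (a1 a2 b1 b2 s t : R) : 0 <= s -> 0 <= t ->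
  (a1 ^+ 2 + a2 ^+ 2) / 2 <= s ^+ 2 -> (b1 ^+ 2 + b2 ^+ 2) / 2 <= t ^+ 2 ->
  ((a1 + b1) ^+ 2 + (a2 + b2) ^+ 2) / 2 <= (s + t) ^+ 2.
Proof.
move=> s0 t0 ha hb.
have ab : a1 * b1 + a2 * b2 <= 2 * (s * t).
  apply: le_trans (ler_norm _) _; rewrite -(@ler_pXn2r _ 2)// ?nnegrE ?mulr_ge0//.
  rewrite real_normK ?num_real//.
  apply: (@le_trans _ _ ((a1 ^+ 2 + a2 ^+ 2) * (b1 ^+ 2 + b2 ^+ 2))).
    rewrite -subr_ge0 [X in 0 <= X](_ : _ = (a1 * b2 - a2 * b1) ^+ 2) ?sqr_ge0//.
    by ring.
  have -> : (2 * (s * t)) ^+ 2 = (2 * s ^+ 2) * (2 * t ^+ 2) by ring.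
  by rewrite ler_pM ?addr_ge0 ?sqr_ge0//; lra.
have -> : ((a1 + b1) ^+ 2 + (a2 + b2) ^+ 2) / 2 =
  (a1 ^+ 2 + a2 ^+ 2) / 2 + (b1 ^+ 2 + b2 ^+ 2) / 2 + (a1 * b1 + a2 * b2) by field.
have -> : (s + t) ^+ 2 = s ^+ 2 + t ^+ 2 + 2 * (s * t) by ring.
by rewrite lerD// lerD.
Qed.

(** The left-hand side is a squared Euclidean norm in the plane, so the
    triangle inequality adds up the two translated inequalities. *)
Lemma two_point_average A v : two_point_contraction A ->
  two_point_contraction (fun x => (A (x + v) + A (x - v)) / 2).
Proof.
move=> [A0 hA]; split=> [x|x u]; first by rewrite divr_ge0 ?addr_ge0.
have h1 := hA (x + v) u; have h2 := hA (x - v) u.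
have s0 : 0 <= (A (x + v + u) + A (x + v - u)) / 2 by rewrite divr_ge0 ?addr_ge0.
have t0 : 0 <= (A (x - v + u) + A (x - v - u)) / 2 by rewrite divr_ge0 ?addr_ge0.
have := minkowski_plane s0 t0 h1 h2.
rewrite ![x + _ + v]addrAC ![x + _ - v]addrAC.
move: (A _) (A _) (A _) (A _) (A _) (A _) (A _) (A _) => a b c d e f g h.
by lra.
Qed.

Lemma two_point_sign_average n y A : two_point_contraction A ->
  two_point_contraction (sign_average n y A).
Proof. by move=> hA; elim: n => //= n; exact: two_point_average. Qed.

(** Conditionally on the last sign, the induction hypothesis bounds the fourth
    moment by the square of a second moment, which as a function of the point
    satisfies the two-point inequality. *)
Lemma hypercontractive n y x :
  sign_average n (fun j => embed k 2^-1 *: y j) (fun x => (rnorm x ^+ 2) ^+ 2) x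
  <= sign_average n y (fun x => rnorm x ^+ 2) x ^+ 2.
Proof.
elim: n x => //= n IHn x.
have [_ /(_ x (y n))] := two_point_sign_average n y two_point_rnorm.
by apply: le_trans; rewrite ler_pM2r// lerD.
Qed.

Lemma sign_averageZ n y (c : R) p x :
  sign_average n (fun j => embed k c *: y j) (fun x => rnorm x ^+ p) (embed k c *: x)
  = `|c| ^+ p * sign_average n y (fun x => rnorm x ^+ p) x.
Proof.
elim: n x => [|n IHn] x /=; first by rewrite rnormZr exprMn.
by rewrite -scalerDr -scalerBr !IHn; ring.
Qed.

(** Hypercontractivity bounds the fourth moment F by 16 M ^ 2, where M is the
    second moment. The first moment L enters through the pointwise bound h ^ 2
    <= l h + h ^ 4 / l ^ 2, valid for every l > 0; the choice l ^ 2 = 32 M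
    makes the last term contribute at most M / 2. *)
Lemma kahane_sign_average n y :
  sign_average n y (fun x => rnorm x ^+ 2) 0
  <= 128 * sign_average n y (fun x => rnorm x) 0 ^+ 2.
Proof.
set M := sign_average _ _ _ _; set L := sign_average _ _ _ _.
have M0 : 0 <= M by apply: sign_average_ge0 => x; exact: sqr_ge0.
have L0 : 0 <= L by apply: sign_average_ge0 => x; exact: rnorm_ge0.
have := hypercontractive n y 0; rewrite -/M.
have := sign_averageZ n y 2^-1 4 0; rewrite scaler0.
have e4 : (fun x : V => (rnorm x ^+ 2) ^+ 2) = (fun x => rnorm x ^+ 4).
  by apply/funext => x; rewrite -exprM.
rewrite e4 => ->; set F := sign_average _ _ _ _ => hF.
have [->|Mn0] := eqVneq M 0; first by rewrite mulr_ge0// sqr_ge0.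
have Mgt0 : 0 < M by rewrite lt_neqAle eq_sym Mn0.
pose l := Num.sqrt (32 * M).
have l0 : 0 < l by rewrite sqrtr_gt0 mulr_gt0.
have l2 : l ^+ 2 = 32 * M by rewrite sqr_sqrtr// mulr_ge0.
have : M <= l * L + (32 * M)^-1 * F.
  rewrite -sign_averageD; apply: sign_average_le => x.
  have r0 := rnorm_ge0 x.
  have [xl|lx] := leP (rnorm x) l.
    apply: (@le_trans _ _ (l * rnorm x)).
      by rewrite expr2 ler_wpM2r.
    by rewrite lerDl mulr_ge0 ?exprn_ge0// invr_ge0 mulr_ge0.
  apply: (@le_trans _ _ ((32 * M)^-1 * rnorm x ^+ 4)); last first.
    by rewrite lerDr mulr_ge0// ltW.
  rewrite -l2 mulrC ler_pdivlMr ?exprn_gt0// -[4%N]/(2 + 2)%N exprD.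
  by rewrite ler_wpM2l ?sqr_ge0// lerXn2r ?nnegrE// ltW.
have hF' : F <= 16 * M ^+ 2.
  have e16 : (2^-1) ^+ 4 = 16^-1 :> R by field.
  by move: hF; rewrite ger0_norm// e16; lra.
have -> : 128 * L ^+ 2 = (2 * (l * L)) ^+ 2 / M.
  by rewrite exprMn exprMn l2; field.
have hM : (32 * M)^-1 * F <= M / 2.
  rewrite mulrC ler_pdivrMr ?mulr_gt0//; apply: le_trans hF' _.
  by rewrite le_eqVlt; apply/orP; left; apply/eqP; field.
move=> h; rewrite ler_pdivlMr// -expr2 lerXn2r ?nnegrE//.
  by rewrite !mulr_ge0// ltW.
by lra.
Qed.

End kahane.

Section kahane_constant.
Variables (R : realType) (k : scalar_kind).

Lemma average_le_Lr (T : finType) (w : R) (h : T -> R) (r : R) :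
  0 <= w -> w * #|T|%:R = 1 -> (forall t, 0 <= h t) -> 1 <= r ->
  \sum_t w * h t <= (\sum_t w * h t `^ r) `^ r^-1.
Proof.
move=> w0 wT h0 r1; have r0 : 0 < r by apply: lt_le_trans r1.
have sw : \sum_(t : T) w * 1 = 1 by rewrite sumr_const -mulr_natr mulr1.
have [->|rn1] := eqVneq r 1.
  rewrite invr1 powRr1; last by apply: sumr_ge0 => t _; rewrite mulr_ge0 ?powR_ge0.
  by apply: ler_sum => t _; rewrite powRr1.
have r1' : 1 < r by rewrite lt_neqAle eq_sym rn1.
pose lam (x : bool) := if x then r^-1 else 1 - r^-1.
pose bb (x : bool) t := if x then h t `^ r else 1.
have lam_gt0 x : lam x > 0 by case: x; rewrite /lam ?invr_gt0 ?subr_gt0 ?invf_lt1.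
have bb0 x t : 0 <= bb x t by case: x => //; exact: powR_ge0.
have lam1 : \sum_x lam x = 1 by rewrite big_bool/= addrC subrK.
have := hoelder_prod (fun x _ => lam_gt0 x) (fun=> w0) (fun x t _ => bb0 x t) lam1.
rewrite [X in _ <= X -> _]big_bool/= sw powR1 mulr1; apply: le_trans.
by apply: ler_sum => t _; rewrite big_bool/= powR1 mulr1 powR_inv_gt0K.
Qed.

Lemma kahane_const_exists (r : R) : 1 <= r -> exists K : R, kahane_const k r 2 K.
Proof.
(* 12 is a rational upper bound for the square root of 128 *)
move=> r1; exists 12; split=> // X n x.
pose y j : X := if insub j is Some i then x i else 0.
have xy (j : 'I_n) : x j = y j by rewrite /y valK.
have avg (g : X -> R) : \sum_(i < 2 ^ n) 2 ^- n * g (\sum_(j < n) x j *~ dyadic_sign n j i)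
    = sign_average n y g 0.
  rewrite -dyadic_averageE; apply: eq_bigr => i _; rewrite add0r.
  by under eq_bigr do rewrite xy.
pose S (i : 'I_(2 ^ n)) := rnorm (\sum_(j < n) x j *~ dyadic_sign n j i).
have S0 i : 0 <= S i by exact: rnorm_ge0.
rewrite !rademacher_meanE -/S.
have m0 : 0 <= 2 ^- n :> R by rewrite invr_ge0 exprn_ge0.
have mT : 2 ^- n * #|'I_(2 ^ n)|%:R = 1 :> R.
  by rewrite card_ord natrX mulVf// expf_neq0.
apply: le_trans (_ : 12 * \sum_(i < 2 ^ n) 2 ^- n * S i <= _); last first.
  by rewrite ler_pM2l//; exact: average_le_Lr.
rewrite (avg (fun x => rnorm x `^ 2)) (avg (fun x => rnorm x)).
have -> : (fun x : X => rnorm x `^ 2) = (fun x => rnorm x ^+ 2).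
  by apply/funext => z; rewrite -powR_mulrn ?rnorm_ge0.
have := kahane_sign_average n y.
set M := sign_average _ _ _ _; set L := sign_average _ _ _ _ => hM.
have M0 : 0 <= M by apply: sign_average_ge0 => ?; exact: sqr_ge0.
have L0 : 0 <= L by apply: sign_average_ge0 => ?; exact: rnorm_ge0.
rewrite powR12_sqrt// -(@ler_pXn2r _ 2)// ?nnegrE ?sqrtr_ge0 ?mulr_ge0//.
by rewrite sqr_sqrtr// exprMn; apply: le_trans hM _; rewrite ler_wpM2r ?sqr_ge0//; lra.
Qed.

End kahane_constant.

(** * Norming functionals and the weak norm *)

Section hahn_banach.
Variables (R : realType) (k : scalar_kind) (V : normedModType (scalars R k)).
Implicit Types (u v w : V) (a b c : R).

(** A real-linear functional on a subspace (or on the empty set) that is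
    bounded by the norm, represented by its graph, so that the union of a
    chain is the union of sets. Being single-valued follows from the bound at
    the origin. *)
Definition dominated_graph (G : set (V * R)) :=
  (forall a p q, G p -> G q -> G (embed k a *: p.1 + q.1, a * p.2 + q.2)) /\
  (forall p, G p -> p.2 <= rnorm p.1).

Definition norm_line (x0 : V) : set (V * R) :=
  [set p | exists a, p = (embed k a *: x0, a * rnorm x0)].

Lemma dominated_norm_line x0 : dominated_graph (norm_line x0).
Proof.
split=> [a p q [b ->] [c ->]|p [a ->]]/=.
  exists (a * b + c); congr (_, _); last by rewrite mulrDl mulrA.
  by rewrite embedD embedM scalerDl scalerA.
by rewrite rnormZr ler_wpM2r ?rnorm_ge0 ?ler_norm.
Qed.

(** The value c at v is admissible when p.2 - | p.1 - v | <= c <= | q.1 + v |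
    - q.2 for all points p and q of the graph. The triangle inequality makes
    each lower bound smaller than each upper bound, so the supremum of the
    lower bounds is such a c. *)
Lemma dominated_graph_extend G v : dominated_graph G -> G !=set0 ->
  (forall a, ~ G (v, a)) ->
  exists H, [/\ dominated_graph H, G `<=` H & exists a, H (v, a)].
Proof.
move=> [Glin Gdom] [p0 Gp0] vG.
have G0 : G (0, 0).
  have := Glin (-1) p0 p0 Gp0 Gp0.
  by rewrite embedN embed1 scaleN1r addNr mulN1r addNr.
pose E := [set p.2 - rnorm (p.1 - v) | p in G].
have sep p q : G p -> G q -> p.2 - rnorm (p.1 - v) <= rnorm (q.1 + v) - q.2.
  move=> Gp Gq; have := Gdom _ (Glin 1 p q Gp Gq); rewrite embed1 scale1r mul1r/=.
  have -> : p.1 + q.1 = (q.1 + v) + (p.1 - v) by rewrite addrACA addrN addr0 addrC.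
  by have := ler_rnormD (q.1 + v) (p.1 - v); lra.
have E0 : E !=set0 by exists (p0.2 - rnorm (p0.1 - v)); exists p0.
have Eub : has_ubound E by exists (rnorm (p0.1 + v) - p0.2) => _ [p Gp <-]; exact: sep.
pose c := sup E.
have cge p : G p -> p.2 - rnorm (p.1 - v) <= c.
  by move=> Gp; apply: ub_le_sup => //; exists p.
have cle q : G q -> c <= rnorm (q.1 + v) - q.2.
  by move=> Gq; apply: ge_sup => // _ [p Gp <-]; exact: sep.
pose H : set (V * R) := [set h | exists p t, G p /\ h = (p.1 + embed k t *: v, p.2 + t * c)].
exists H; split.
- split=> [a _ _ [p [t [Gp ->]]] [q [s [Gq ->]]]|_ [p [t [Gp ->]]]] /=.
    exists (embed k a *: p.1 + q.1, a * p.2 + q.2), (a * t + s); split; first exact: Glin.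
    congr (_, _) => /=; last by ring.
    by rewrite scalerDr addrACA scalerA embedD embedM scalerDl.
  have [t0|t0|->] := ltgtP t 0; last first.
  + by rewrite embed0 scale0r mul0r !addr0; exact: Gdom.
  + have := cle _ (Glin t^-1 p (0, 0) Gp G0); rewrite /= !addr0.
    have -> : embed k t^-1 *: p.1 + v = embed k t^-1 *: (p.1 + embed k t *: v).
      by rewrite scalerDr scalerA -embedM mulVf ?gt_eqF// embed1 scale1r.
    rewrite rnormZr gtr0_norm ?invr_gt0// -mulrBr ler_pdivlMl// lerBrDl.
    by rewrite addrC.
  + have nt0 : 0 < - t by rewrite oppr_gt0.
    have := cge _ (Glin (- t)^-1 p (0, 0) Gp G0); rewrite /= !addr0.
    have -> : embed k (- t)^-1 *: p.1 - v = embed k (- t)^-1 *: (p.1 + embed k t *: v).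
      have e : (- t)^-1 * t = - 1 by rewrite invrN mulNr mulVf ?lt_eqF.
      by rewrite scalerDr scalerA -embedM e embedN embed1 scaleN1r.
    rewrite rnormZr gtr0_norm ?invr_gt0// -mulrBr ler_pdivrMl// mulNr.
    by move: (t * c) => tc; lra.
- by move=> p Gp; exists p, 0; split=> //; rewrite embed0 scale0r mul0r !addr0; case: p {Gp}.
- by exists c, (0, 0), 1; split=> //=; rewrite embed1 scale1r mul1r !add0r.
Qed.

(** Zorn's lemma on dominated graphs that contain the line through x0. The
    empty graph is admitted as well, since it is the union of the empty chain,
    and it is not maximal. *)
Lemma real_hahn_banach x0 : exists g : V -> R,
  [/\ forall a u v, g (embed k a *: u + v) = a * g u + g v,
      forall v, g v <= rnorm v & g x0 = rnorm x0].
Proof.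
pose P (G : set (V * R)) := G = set0 \/ (norm_line x0 `<=` G /\ dominated_graph G).
have [|G [PG Gmax]] := @Zorn_bigcup _ P.
  move=> F FP Ftot; have [->|] := eqVneq (\bigcup_(X in F) X) set0.
    by left.
  move=> /set0P[p [G FG Gp]]; right; split.
    case: (FP _ FG) => [G0|[xG _] q xq]; first by move: Gp; rewrite G0.
    by exists G => //; exact: xG.
  split=> [a q r [G1 FG1 Gq] [G2 FG2 Gr]|q [G1 FG1 Gq]]; last first.
    by case: (FP _ FG1) => [G0|[_ [_]]]; [move: Gq; rewrite G0|exact].
  have [G12|G21] := Ftot _ _ FG1 FG2.
    (* both points lie in the larger of the two members of the chain *)
    exists G2 => //; case: (FP _ FG2) => [G0|[_ [Glin _]]].
      by move: Gr; rewrite G0.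
    by apply: Glin => //; exact: G12.
  exists G1 => //; case: (FP _ FG1) => [G0|[_ [Glin _]]].
    by move: Gq; rewrite G0.
  by apply: Glin => //; exact: G21.
have line0 : norm_line x0 (x0, rnorm x0) by exists 1; rewrite embed1 scale1r mul1r.
case: PG => [G0|[xG domG]].
  exfalso; apply: (Gmax (norm_line x0)); last by right; split=> //; exact: dominated_norm_line.
  by rewrite G0; split=> // /(_ _ line0).
have Gtot v : exists a, G (v, a).
  apply: contrapT => /forallNP vG.
  have [H [domH GH [a Hva]]] := dominated_graph_extend domG (ex_intro _ _ (xG _ line0)) vG.
  apply: (Gmax H); last by right; split=> //; exact: subset_trans GH.
  by split=> // /(_ _ Hva); exact: vG.
have [g Gg] := choice Gtot; case: domG => Glin Gdom.
have Guniq v a b : G (v, a) -> G (v, b) -> a <= b.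
  move=> Ga Gb; have := Gdom _ (Glin (-1) _ _ Gb Ga).
  by rewrite /= embedN embed1 scaleN1r addNr rnorm0 mulN1r addrC subr_le0.
have Geq v a : G (v, a) -> g v = a.
  by move=> Ga; apply/eqP; rewrite eq_le (Guniq _ _ _ (Gg v) Ga) (Guniq _ _ _ Ga (Gg v)).
exists g; split=> [a u v|v|]; last exact/Geq/xG.
  exact/Geq/(Glin a (u, g u) (v, g v)).
exact: (Gdom _ (Gg v)).
Qed.

Lemma dual_unit_ball_le (f : {linear V -> (scalars R k)^o}) v :
  dual_unit_ball f -> rnorm (f v) <= rnorm v.
Proof.
move=> fB; have [->|v0] := eqVneq v 0; first by rewrite linear0 !rnorm0.
have vp : 0 < rnorm v by rewrite lt_neqAle eq_sym rnorm_eq0 v0 rnorm_ge0.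
have := fB (embed k (rnorm v)^-1 *: v).
rewrite rnormZr gtr0_norm ?invr_gt0// mulVf ?gt_eqF// => /(_ (lexx _)).
rewrite linearZ/= rnormZr.
by rewrite gtr0_norm ?invr_gt0// ler_pdivrMl// mulr1.
Qed.

Lemma linear_pack (f : V -> (scalars R k)^o) : linear f ->
  exists F : {linear V -> (scalars R k)^o}, forall v, F v = f v.
Proof.
move=> lf.
by exists (HB.pack f (GRing.isLinear.Build _ _ _ _ _ lf) : {linear V -> (scalars R k)^o}).
Qed.

End hahn_banach.

(** Over the complex numbers, the real functional g becomes the real part of
    the linear functional v |-> g v - i g (i v), whose norm is not larger
    because each of its values can be rotated to a real one. *)
Lemma norming_functional (R : realType) k (V : normedModType (scalars R k)) (x0 : V) :
  exists2 f : {linear V -> (scalars R k)^o}, dual_unit_ball f & rnorm x0 <= rnorm (f x0).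
Proof.
have [g [glin gdom gx0]] := real_hahn_banach x0.
have gN v : g (- v) = - g v.
  have g0 : g 0 = 0.
    have := glin (-1) 0 0; rewrite scaler0 addr0 mulN1r addNr => ->. by [].
  by have := glin (-1) v 0; rewrite embedN embed1 scaleN1r addr0 g0 addr0 mulN1r.
case: k V x0 g glin gdom gx0 gN => V x0 g glin gdom gx0 gN.
  have [f fE] := @linear_pack R RealScalars V g glin.
  exists f; last by rewrite fE -gx0; exact: ler_norm.
  move=> v v1; rewrite fE /rnorm /=.
  rewrite ler_norml (le_trans (gdom v) v1) andbT lerNl -gN.
  by apply: le_trans (gdom _) _; rewrite rnormN.
pose i : R[i] := Complex 0 1.
pose f (v : V) : (scalars R ComplexScalars)^o := Complex (g v) (- g (i *: v)).
have gD u v : g (u + v) = g u + g v.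
  by have := glin 1 u v; rewrite embed1 scale1r mul1r.
have gZ a v : g ((Complex a 0) *: v) = a * g v.
  have g0 : g 0 = 0 by have := gN 0; rewrite oppr0 => h; lra.
  by have := glin a v 0; rewrite !addr0 g0 addr0.
have gC (a b : R) v : g (Complex a b *: v) = a * g v + b * g (i *: v).
  have -> : Complex a b = Complex a 0 + Complex b 0 * i by rewrite /i; simpc.
  by rewrite scalerDl gD gZ -scalerA gZ.
have flin : linear f.
  move=> [a b] u v.
  have e1 : g (Complex a b *: u + v) = a * g u + b * g (i *: u) + g v.
    by rewrite gD gC.
  have e2 : g (i *: (Complex a b *: u + v)) = - b * g u + a * g (i *: u) + g (i *: v).
    have -> : i *: (Complex a b *: u + v) = Complex (- b) a *: u + i *: v.
      rewrite scalerDr scalerA; congr (_ *: _ + _).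
      by rewrite /i; simpc.
    by rewrite gD gC.
  rewrite /f e1 e2.
  change (Complex (a * g u + b * g (i *: u) + g v)
                  (- (- b * g u + a * g (i *: u) + g (i *: v))) =
    Complex a b * Complex (g u) (- g (i *: u)) + Complex (g v) (- g (i *: v))).
  move: (g u) (g v) (g (i *: u)) (g (i *: v)) => p q r s.
  by simpc; congr Complex; ring.
have [F FE] := @linear_pack R ComplexScalars V f flin.
have rn (z : (scalars R ComplexScalars)^o) :
    rnorm z = Num.sqrt (complex.Re z ^+ 2 + complex.Im z ^+ 2).
  rewrite /rnorm.
  change (complex.Re `|z : R[i]| = Num.sqrt (complex.Re z ^+ 2 + complex.Im z ^+ 2)).
  by rewrite normc_def.
exists F; last first.
  rewrite FE -gx0 rn; apply: le_trans (ler_norm _) _.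
  by rewrite -sqrtr_sqr ler_wsqrtr// lerDl sqr_ge0.
move=> v; apply: le_trans; rewrite FE rn /f /= sqrrN.
set s := g v ^+ 2 + _; have s0 : 0 <= s by rewrite addr_ge0 ?sqr_ge0.
have [->|sn0] := eqVneq (Num.sqrt s) 0; first exact: (@rnorm_ge0 R ComplexScalars V v).
have sp : 0 < Num.sqrt s by rewrite lt_neqAle eq_sym sn0 sqrtr_ge0.
rewrite -(ler_pM2l sp) -expr2 sqr_sqrtr//.
have := gdom (Complex (g v) (g (i *: v)) *: v); rewrite gC -!expr2 -/s => /le_trans; apply.
rewrite rnormZ le_eqVlt; apply/orP; left; apply/eqP.
by congr (_ * _).
Qed.

Section weak_l1.
Variables (R : realType) (k : scalar_kind) (V : normedModType (scalars R k)).
Variable n : nat.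
Implicit Types x : 'I_n -> V.

Lemma weak_l1_has_ubound x :
  has_ubound [set \sum_(i < n) rnorm (f (x i)) | f in @dual_unit_ball R k V].
Proof.
exists (\sum_(i < n) rnorm (x i)) => _ [f fB <-].
by apply: ler_sum => i _; exact: dual_unit_ball_le.
Qed.

Lemma le_weak_l1 x (f : {linear V -> (scalars R k)^o}) : dual_unit_ball f ->
  \sum_(i < n) rnorm (f (x i)) <= weak_l1_norm x.
Proof. by move=> fB; apply: ub_le_sup; [exact: weak_l1_has_ubound|exists f]. Qed.

Lemma weak_l1_ge0 x : 0 <= weak_l1_norm x.
Proof.
have [f fB _] := norming_functional (0 : V).
by apply: le_trans (le_weak_l1 x fB); apply: sumr_ge0 => i _; exact: rnorm_ge0.
Qed.

(** Apply a functional that norms the signed sum: the signs disappear in the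
    absolute values. *)
Lemma rnorm_signed_sum_le x (e : nat -> nat) :
  rnorm (\sum_(i < n) x i *~ (-1) ^+ e i) <= weak_l1_norm x.
Proof.
have [f fB] := norming_functional (\sum_(i < n) x i *~ (-1) ^+ e i).
move=> /le_trans; apply; apply: le_trans (le_weak_l1 x fB).
rewrite raddf_sum; apply: le_trans (ler_rnorm_sum _ _ _) _.
apply: ler_sum => i _; rewrite raddfMz -signr_odd.
by case: odd; rewrite ?expr0 ?expr1 ?mulr1z ?mulrN1z ?rnormN.
Qed.

End weak_l1.

(** * Uniform boundedness of seminorms *)

Section uniform_boundedness.
Variables (R : realType) (k : scalar_kind).

Lemma geometric_cauchy_limit (V : completeNormedModType (scalars R k)) (x : nat -> V) :
  (forall n, rnorm (x n.+1 - x n) <= 3 ^- n) ->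
  exists l, forall n, rnorm (l - x n) <= 3 / 2 * 3 ^- n.
Proof.
move=> xS.
have p3 n : 0 < 3 ^- n :> R by rewrite invr_gt0 exprn_gt0.
have step n d : rnorm (x (n + d)%N - x n) <= 3 / 2 * (3 ^- n - 3 ^- (n + d)).
  elim: d => [|d IHd]; first by rewrite addn0 !subrr rnorm0 mulr0.
  rewrite addnS -(subrK (x (n + d)%N) (x _.+1)) -addrA.
  apply: le_trans (ler_rnormD _ _) _; apply: le_trans (lerD (xS _) IHd) _.
  have -> : 3 ^- (n + d).+1 = 3 ^- (n + d) / 3 :> R by rewrite exprS invfM mulrC.
  by lra.
have steple n m : (n <= m)%N -> rnorm (x m - x n) < 3 / 2 * 3 ^- n.
  move=> /subnKC <-; apply: le_lt_trans (step _ _) _.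
  by rewrite ltr_pM2l ?divr_gt0// ltrBlDr ltrDl.
have small (e : R) : 0 < e -> exists n, 3 / 2 * 3 ^- n < e.
  move=> e0; pose N := (Num.truncn (3 / 2 / e)).+1; exists N.
  have := truncnS_gt (3 / 2 / e); rewrite -/N ltr_pdivrMr// => NE.
  rewrite ltr_pdivrMr ?exprn_gt0//; apply: lt_trans NE _.
  by rewrite mulrC ltr_pM2l// -(natrX _ 3) ltr_nat ltn_expl.
have cx : cauchy (x @ \oo).
  apply: cauchy_exP => e e0; have eE := scalar_reK (ltW e0).
  have e'0 : 0 < scalar_re e by rewrite -(embed_lt k) eE embed0.
  have [n ne] := small _ e'0; exists (x n); exists n => // m /= nm.
  rewrite -ball_normE /ball_/= norm_rnormE rnormB -eE embed_lt.
  exact: lt_trans (steple _ _ nm) ne.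
have : cvg (x @ \oo) by exact: cauchy_cvg.
move=> /cvg_ex[l xl]; exists l => n.
apply/ler_addgt0Pr => e e0.
have e0' : 0 < embed k e by rewrite -(embed0 R k) embed_lt.
have [N _ Nl] : \forall m \near \oo, `|l - x m| < embed k e.
  exact: (@cvgr_dist_lt _ _ _ _ _ _ _ xl).
have := Nl (maxn N n) (leq_maxl _ _); rewrite /= norm_rnormE embed_lt => h.
rewrite -(subrK (x (maxn N n)) l) -addrA; apply: le_trans (ler_rnormD _ _) _.
by rewrite [leRHS]addrC lerD// ltW// steple ?leq_maxr.
Qed.

(** A gliding hump without Baire's theorem. If the bound fails, some p_n among
    the p j has norm N >= 4 ^ n, nearly attained (up to the factor 2/3) at a
    unit vector u_n. Let x_(n+1) = x_n +- 3 ^ - n u_n, with the sign for which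
    p_n (x_(n+1)) >= 3 ^ - n p_n (u_n); this is possible as 2 p_n h <= p_n (x
    + h) + p_n (x - h). The distance from x_(n+1) to the limit is at most 3 ^
    - n / 2, so p_n at the limit is at least (2/3 - 1/2) 3 ^ - n N >= (4/3) ^
    n / 6, which is unbounded. The statement is about seminorms because it
    will be applied to l_r-sums of norms of values of a linear map. *)
Theorem uniform_boundedness (V : completeNormedModType (scalars R k)) (J : Type)
    (p : J -> V -> R) :
  (forall j u v, p j (u + v) <= p j u + p j v) ->
  (forall j a u, p j (embed k a *: u) = `|a| * p j u) ->
  (forall j, exists C, forall u, p j u <= C * rnorm u) ->
  (forall u, exists C, forall j, p j u <= C) ->
  exists C, forall j u, rnorm u <= 1 -> p j u <= C.
Proof.
move=> pD pZ pC ptw; apply: contrapT => /forallNP nb.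
have pN j u : p j (- u) = p j u.
  by have := pZ j (-1) u; rewrite embedN embed1 scaleN1r normrN normr1 mul1r.
have wit n : exists t : J * V * R, [/\ rnorm t.1.2 <= 1, 4 ^+ n <= t.2,
    2 / 3 * t.2 <= p t.1.1 t.1.2 & forall u, p t.1.1 u <= t.2 * rnorm u].
  have /existsNP[j /existsNP[u]] := nb (4 ^+ n).
  move=> /not_implyP[u1 /negP]; rewrite -ltNge => pu.
  have [C jC] := pC j; pose E := [set p j u | u in [set u | rnorm u <= 1]].
  have Eub : has_ubound E.
    exists (Num.max C 0) => _ [w /= w1 <-]; apply: le_trans (jC w) _.
    have [C0|C0] := leP 0 C; first by rewrite ler_piMr.
    by rewrite nmulr_rle0 ?rnorm_ge0.
  have E0 : E !=set0 by exists (p j u), u.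
  have uN : p j u <= sup E by apply: ub_le_sup => //; exists u.
  have Np : 0 < sup E by apply: lt_le_trans uN; apply: lt_trans pu; rewrite exprn_gt0.
  (* a unit vector at which p j attains two thirds of its norm *)
  have [_ [w w1 <-] wN] : exists2 b, E b & sup E - sup E / 3 < b.
    by apply: sup_adherent; [rewrite divr_gt0|split].
  exists ((j, w), sup E); split=> //=; first exact: ltW (lt_le_trans pu uN).
    by apply: le_trans (ltW wN); lra.
  move=> v; have [->|v0] := eqVneq v 0.
    by have := pZ j 0 0; rewrite scaler0 normr0 mul0r rnorm0 mulr0 => ->.
  have vp : 0 < rnorm v by rewrite lt_neqAle eq_sym rnorm_eq0 v0 rnorm_ge0.
  have Ev : E (p j (embed k (rnorm v)^-1 *: v)).
    exists (embed k (rnorm v)^-1 *: v) => //=.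
    by rewrite rnormZr gtr0_norm ?invr_gt0// mulVf// gt_eqF.
  have := ub_le_sup Eub Ev.
  by rewrite pZ gtr0_norm ?invr_gt0// ler_pdivrMl// [leRHS]mulrC.
have [t tP] := choice wit.
pose q n := p (t n).1.1; pose h n := embed k (3 ^- n) *: (t n).1.2.
have p3 n : 0 < 3 ^- n :> R by rewrite invr_gt0 exprn_gt0.
pose x := fix x n := if n is m.+1 then
   (if q m (h m) <= q m (x m + h m) then x m + h m else x m - h m) else 0.
have hn n : rnorm (h n) <= 3 ^- n.
  by rewrite /h rnormZr gtr0_norm// ler_piMr ?(ltW (p3 n))//; case: (tP n).
have [l lP] : exists l, forall n, rnorm (l - x n) <= 3 / 2 * 3 ^- n.
  apply: geometric_cauchy_limit => n /=.
  by case: ifP => _; rewrite addrAC subrr add0r ?rnormN.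
have qx n : q n (h n) <= q n (x n.+1).
  rewrite /=; case: ifPn => //; rewrite -ltNge => lt1.
  have e2 : h n + h n = (x n + h n) - (x n - h n) by rewrite opprD opprK addrACA subrr add0r.
  have : 2 * q n (h n) <= q n (x n + h n) + q n (x n - h n).
    rewrite -[q n (x n - h n)]/(p _ _) -pN -/(q n _); apply: le_trans (pD _ _ _).
    rewrite -e2 -[2](ger0_norm (ler0n R 2)) -pZ.
    have -> : embed k 2 = 1 + 1 :> scalars R k by rewrite -(embed1 R k) -embedD.
    by rewrite scalerDl scale1r.
  by move: lt1; lra.
have [C lC] := ptw l.
have low n : (4 / 3) ^+ n / 6 <= C.
  apply: le_trans (lC (t n).1.1); have [u1 N4 pu pN'] := tP n.
  have : q n (x n.+1) <= q n l + q n (x n.+1 - l).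
    by rewrite -{1}(subrK l (x n.+1)) addrC; exact: pD.
  have : q n (x n.+1 - l) <= (t n).2 * (3 / 2 * 3 ^- n.+1).
    apply: le_trans (pN' _) _; rewrite ler_wpM2l//.
      by apply: le_trans N4; rewrite exprn_ge0.
    by rewrite rnormB; exact: lP.
  have := qx n; rewrite /h /q pZ gtr0_norm// -/(q n).
  have := ler_wpM2l (ltW (p3 n)) pu; have := ler_wpM2l (ltW (p3 n)) N4.
  have -> : 3 ^- n.+1 = 3 ^- n / 3 :> R by rewrite exprS invfM mulrC.
  rewrite expr_div_n [4 ^+ n / _]mulrC -/(q n).
  rewrite -/(q n l); move: (3 ^- n) (t n).2 (q n _) (q n _) (q n _) (4 ^+ n) => a b c d e f.
  by move=> *; lra.
(* by Bernoulli's inequality the lower bounds exceed C once n > 18 C *)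
have := low (Num.truncn (18 * C)).+1.
have bern n : 1 + n%:R / 3 <= (4 / 3) ^+ n :> R.
  elim: n => [|n IHn]; first by rewrite mul0r addr0 expr0.
  rewrite exprS; have : 4 / 3 * (1 + n%:R / 3) <= 4 / 3 * (4 / 3) ^+ n :> R.
    by rewrite ler_wpM2l.
  apply: le_trans; have := ler0n R n; rewrite -natr1; lra.
have := bern (Num.truncn (18 * C)).+1; have := truncnS_gt (18 * C).
by lra.
Qed.

End uniform_boundedness.

(** * Multilinear maps and gluing of coordinates *)

Section multilinear_theory.
Variables (R : realType) (k : scalar_kind) (I : finType).
Variables (X : I -> completeNormedModType (scalars R k)).
Variables (Y : completeNormedModType (scalars R k)) (U : (forall i, X i) -> Y).

Lemma multilinear_pack : multilinear U -> forall x i,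
  exists L : {linear X i -> Y}, forall u, L u = U (dfwith x i u).
Proof.
move=> Um x i; pose f u := U (dfwith x i u).
have lf : linear f by move=> a u v; exact: Um.
by exists (HB.pack f (GRing.isLinear.Build _ _ _ _ _ lf) : {linear X i -> Y}).
Qed.

Lemma dfwith_id (z : forall i, X i) i : dfwith z i (z i) = z.
Proof.
by apply: functional_extensionality_dep => j; case: dfwithP.
Qed.

Lemma multilinear_scale : multilinear U -> forall (a : I -> R) x,
  U (fun i => embed k (a i) *: x i) = embed k (\prod_i a i) *: U x.
Proof.
move=> Um a x; pose z (s : seq I) i := if i \in s then embed k (a i) *: x i else x i.
suff zs s : uniq s -> U (z s) = embed k (\prod_(i <- s) a i) *: U x.
  have := zs (enum I) (enum_uniq I); rewrite big_enum/= => <-.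
  by congr U; apply: functional_extensionality_dep => i; rewrite /z mem_enum.
elim: s => [_|j s IHs /= /andP[js us]]; first by rewrite big_nil embed1 scale1r.
have [L LE] := multilinear_pack Um (z s) j.
have -> : z (j :: s) = dfwith (z s) j (embed k (a j) *: x j).
  apply: functional_extensionality_dep => i; case: dfwithP => [|i' ji].
    by rewrite /z mem_head.
  by rewrite /z inE eq_sym (negbTE ji).
rewrite -LE linearZ/= LE big_cons embedM -scalerA -IHs//; congr (_ *: U _).
by rewrite -[RHS](dfwith_id _ j) {3}/z (negbTE js).
Qed.

Lemma rnorm_multilinear_scale : multilinear U -> forall (a : I -> R) x,
  (forall i, 0 <= a i) ->
  rnorm (U (fun i => embed k (a i) *: x i)) = (\prod_i a i) * rnorm (U x).
Proof.
by move=> Um a x a0; rewrite multilinear_scale// rnormZr ger0_norm// prodr_ge0.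
Qed.

(** Because w = 0 serves for v = 0, homogeneity arguments need not distinguish
    the coordinates that vanish. *)
Lemma rnorm_normalize (V : normedModType (scalars R k)) (v : V) :
  exists2 w : V, rnorm w <= 1 & v = embed k (rnorm v) *: w.
Proof.
have [->|v0] := eqVneq v 0; first by exists 0; rewrite ?rnorm0 ?ler01 ?scaler0.
have vp : 0 < rnorm v by rewrite lt_neqAle eq_sym rnorm_eq0 v0 rnorm_ge0.
exists (embed k (rnorm v)^-1 *: v).
  by rewrite rnormZr gtr0_norm ?invr_gt0// mulVf// gt_eqF.
by rewrite scalerA -embedM divff ?gt_eqF// embed1 scale1r.
Qed.

Lemma rnorm_normalize_all (x : forall i, X i) : exists2 w : forall i, X i,
  in_unit_balls w & x = (fun i => embed k (rnorm (x i)) *: w i).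
Proof.
have h i : {w : X i | rnorm w <= 1 & x i = embed k (rnorm (x i)) *: w}.
  by apply: cid2; exact: rnorm_normalize.
exists (fun i => s2val (h i)) => [i|]; first exact: s2valP (h i).
by apply: functional_extensionality_dep => i; exact: s2valP' (h i).
Qed.

Lemma bounded_multilinear_le : bounded_multilinear U ->
  exists2 C, 0 <= C & forall x, rnorm (U x) <= C * \prod_i rnorm (x i).
Proof.
move=> [Um [C UC]]; exists `|C| => // x.
have [w w1 e] := rnorm_normalize_all x; rewrite [in leLHS]e.
rewrite rnorm_multilinear_scale => // [|i]; last exact: rnorm_ge0.
rewrite mulrC; apply: ler_pM; rewrite ?rnorm_ge0//.
- by apply: prodr_ge0 => i _; exact: rnorm_ge0.
- by apply: le_trans (UC _ w1) _; exact: ler_norm.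
Qed.

End multilinear_theory.

Section glue.
Variables (R : realType) (k : scalar_kind) (I : finType).
Variables (X : I -> completeNormedModType (scalars R k)) (D : {set I}).
Implicit Types (x : forall j, subfamily X (~: D) j) (y : forall j, subfamily X D j).

Lemma glue_coords_in x y (j : {i | i \in D}) : glue_coords x y (val j) = y j.
Proof.
rewrite /glue_coords; case: pselect => [h|]; last by case: j.
by case: j h => i iD h /=; rewrite (bool_irrelevance h iD).
Qed.

Lemma glue_coords_out x y (j : {i | i \in ~: D}) : glue_coords x y (val j) = x j.
Proof.
rewrite /glue_coords; case: pselect => [h|h].
  by exfalso; case: j h => i /= h; rewrite finset.in_setC in h; exact/negP.
case: j h => i iD h /=; congr (x (exist _ _ _)); exact: bool_irrelevance.
Qed.

Lemma in_set_sig (E : {set I}) (i : I) : i \in E -> exists j : {i | i \in E}, val j = i.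
Proof. by move=> iD; exists (exist _ i iD). Qed.

(** Both conditions quantify over the subtypes of coordinates, where the types
    of the vectors agree by conversion, so that equalities of glued points
    need no transport. *)
Lemma glue_coordsP (z : forall i, X i) x y :
  (forall j : {i | i \in D}, z (val j) = y j) ->
  (forall j : {i | i \in ~: D}, z (val j) = x j) -> glue_coords x y = z.
Proof.
move=> zy zx; apply: functional_extensionality_dep => i.
have [iD|] := boolP (i \in D).
  by have [j <-] := in_set_sig iD; rewrite glue_coords_in zy.
rewrite -finset.in_setC => /in_set_sig[j <-].
by rewrite glue_coords_out zx.
Qed.

Lemma glue_coords_dfwith_in x y (j : {i | i \in D}) (u : X (val j)) :
  glue_coords x (dfwith y j u) = dfwith (glue_coords x y) (val j) u.
Proof.
apply: glue_coordsP => l.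
  have [<-|jl] := eqVneq j l; first by rewrite !dfwithin.
  rewrite !dfwithout ?glue_coords_in//.
rewrite dfwithout ?glue_coords_out//; apply: contraTneq (valP l) => <-.
by rewrite finset.in_setC negbK; exact: valP j.
Qed.

Lemma glue_coords_dfwith_out (z : forall i, X i) y (j : I) (u : X j) : j \notin D ->
  glue_coords (fun l => dfwith z j u (val l)) y
  = dfwith (glue_coords (fun l => z (val l)) y) j u.
Proof.
move=> jD; apply: glue_coordsP => l.
  rewrite dfwithout ?glue_coords_in//; apply: contraNneq jD => ->; exact: valP l.
have [e|jl] := eqVneq j (val l); last by rewrite !dfwithout// glue_coords_out.
by subst j; rewrite !dfwithin.
Qed.

End glue.

Section restriction.
Variables (R : realType) (k : scalar_kind) (I : finType).
Variables (X : I -> completeNormedModType (scalars R k)).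
Variables (Y : completeNormedModType (scalars R k)) (U : (forall i, X i) -> Y).

Lemma bounded_multilinear_restr (D : {set I}) (x : forall j, subfamily X (~: D) j) :
  bounded_multilinear U -> bounded_multilinear (coord_restr U x).
Proof.
move=> hU; have [C C0 UC] := bounded_multilinear_le hU; split.
  move=> y j a u v; rewrite /coord_restr !glue_coords_dfwith_in; exact: hU.1.
(* the norms of the fixed coordinates, and 1 for those in the unit ball *)
pose B i := if pselect (i \in ~: D) is left h then rnorm (x (exist _ i h)) else 1.
exists (C * \prod_i B i) => y y1; apply: le_trans (UC _) _.
rewrite ler_wpM2l// ler_prod// => i _; rewrite rnorm_ge0/= /B.
case: pselect => [h|h].
  by rewrite -(glue_coords_out x y (exist _ i h)).
have iD : i \in D by move/negP: h; rewrite finset.in_setC negbK.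
have [j <-] := in_set_sig iD; rewrite glue_coords_in; exact: y1.
Qed.

End restriction.

(** * The mixed-norm estimate and its interpolation *)

Section core.
Variables (R : realType) (k : scalar_kind) (I : finType).
Variables (X : I -> completeNormedModType (scalars R k)).
Variables (Y : completeNormedModType (scalars R k)) (U : (forall i, X i) -> Y).

Local Notation F := (fun z => rnorm (U z)).

Lemma sum_coord_norms (M : nat) (x : forall j, 'I_M.+1 -> X j) (p : R) z : 0 < p ->
  (\sum_(h : {ffun I -> 'I_M.+1}) rnorm (U (fun j => x j (h j))) `^ p) `^ p^-1
  = coord_norms (samples R x) (fun=> p) (enum I) F z.
Proof.
move=> p0; pose h0 := [ffun _ : I => ord0 : 'I_M.+1].
have F0 : forall z, 0 <= F z by move=> ?; exact: rnorm_ge0.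
rewrite (@coord_norms_eq_off R I X _ _ _ _ z (select x I z h0)); last first.
  by move=> i; rewrite mem_enum.
rewrite -[RHS](powR_inv_gt0K p0) ?coord_norms_ge0// coord_norms_sum ?enum_uniq//.
congr (_ `^ _); apply: eq_big => h; last by [].
by apply/esym/familyP => i; rewrite mem_enum.
Qed.

(** Multi-indices over S are identified with the multi-indices over I that
    take the default value ord0 outside S. *)
Lemma sum_sub_coord_norms (S : {set I}) (M : nat) (x : forall j, 'I_M.+1 -> X j) (p : R)
    (z : forall i, X i) : 0 < p ->
  (\sum_(h : {ffun {i | i \in S} -> 'I_M.+1})
     rnorm (coord_restr U (fun l : {i | i \in ~: S} => z (val l))
              (fun j => x (val j) (h j))) `^ p) `^ p^-1
  = coord_norms (samples R x) (fun=> p) (enum S) F z.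
Proof.
move=> p0; pose h0 := [ffun _ : I => ord0 : 'I_M.+1].
have F0 : forall z, 0 <= F z by move=> ?; exact: rnorm_ge0.
rewrite (@coord_norms_eq_off R I X _ _ _ _ z (select x (mem S) z h0)); last first.
  by move=> i; rewrite mem_enum /select => /negbTE iS; rewrite [_ \in _]iS.
rewrite -[RHS](powR_inv_gt0K p0) ?coord_norms_ge0// coord_norms_sum ?enum_uniq//; last first.
  by move=> i; rewrite mem_enum.
congr (_ `^ _).
pose e (h : {ffun {i | i \in S} -> 'I_M.+1}) : {ffun I -> 'I_M.+1} :=
  [ffun i => if insub i is Some j then h j else ord0].
pose e' (h : {ffun I -> 'I_M.+1}) : {ffun {i | i \in S} -> 'I_M.+1} :=
  [ffun j => h (val j)].
rewrite (reindex_onto e e') => [|h /familyP hP]; last first.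
  apply/ffunP => i; rewrite ffunE; case: insubP => [j iS ji|iS]; first by rewrite ffunE ji.
  by have := hP i; rewrite mem_enum (negbTE iS) inE ffunE => /eqP.
apply: eq_big => h.
  apply/esym/andP; split.
    apply/familyP => i; rewrite mem_enum; have [//|iS] := boolP (i \in S).
    by rewrite inE !ffunE insubF//; exact/negbTE.
  by apply/eqP/ffunP => j; rewrite !ffunE valK.
move=> _; congr (rnorm (U _) `^ _); apply: glue_coordsP => j.
  by rewrite /select ffunE valK [_ \in _](valP j).
rewrite /select; have := valP j; rewrite finset.in_setC => /negbTE jS.
by rewrite [_ \in _]jS.
Qed.

Lemma dyadic_weight_ge0 (M : nat) : 0 <= 2 ^- M :> R.
Proof. by rewrite invr_ge0 exprn_ge0. Qed.

Definition rademacher_sums (M : nat) (x : forall j, 'I_M -> X j) j : sampling R (X j) :=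
  @Sampling R (X j) 'I_(2 ^ M) (2 ^- M) (dyadic_weight_ge0 M)
    (fun i => \sum_(t < M) x j t *~ dyadic_sign M t i).

Lemma prod_sig (D : {set I}) (f : I -> R) :
  \prod_(i in D) f i = \prod_(j : {i | i \in D}) f (val j).
Proof. exact: big_sub. Qed.

Lemma summing_bound_le (J : finType) (Z : J -> completeNormedModType (scalars R k))
    (V : (forall j, Z j) -> Y) (r C C' : R) :
  C <= C' -> summing_bound r V C -> summing_bound r V C'.
Proof.
move=> CC' VC M y; apply: le_trans (VC M y) _; rewrite ler_wpM2r//.
by apply: prodr_ge0 => j _; exact: weak_l1_ge0.
Qed.

(** A summing bound on the product of the unit balls extends to all points by
    homogeneity in the fixed coordinates. *)
Lemma summing_bound_restr (S : {set I}) (r C : R) :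
  multilinear U -> 0 < r -> 0 <= C ->
  (forall x, in_unit_balls x -> summing_bound r (@coord_restr R k I X Y U S x) C) ->
  forall x, summing_bound r (@coord_restr R k I X Y U S x) (C * \prod_j rnorm (x j)).
Proof.
move=> Um r0 C0 hC x M y; have [w w1 xw] := rnorm_normalize_all x.
set P := \prod_j rnorm (x j); have P0 : 0 <= P by apply: prodr_ge0 => j _; exact: rnorm_ge0.
pose a i := if pselect (i \in ~: S) is left h then rnorm (x (exist _ i h)) else 1.
have a0 i : 0 <= a i by rewrite /a; case: pselect => // h; exact: rnorm_ge0.
have aE (j : {i | i \in ~: S}) : a (val j) = rnorm (x j).
  rewrite /a; case: pselect => [h|]; last by case: j.
  by case: j h => i iS h /=; rewrite (bool_irrelevance h iS).
have aS (j : {i | i \in S}) : a (val j) = 1.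
  rewrite /a; case: pselect => // h; exfalso.
  by have := h; rewrite finset.in_setC (valP j).
have prodE : \prod_i a i = P.
  rewrite (bigID (mem S))/= big1 ?mul1r => [|i iS]; last first.
    by have [j <-] := in_set_sig iS.
  rewrite (eq_bigl (mem (~: S))) => [|i]; last by rewrite inE finset.in_setC.
  rewrite prod_sig; apply: eq_bigr => j _; exact: aE.
have gE v : glue_coords x v = (fun i => embed k (a i) *: glue_coords w v i).
  apply: glue_coordsP => j; first by rewrite aS embed1 scale1r glue_coords_in.
  by rewrite aE glue_coords_out [in RHS]xw.
have -> : (\sum_(i : {ffun {i | i \in S} -> 'I_M})
    rnorm (coord_restr U x (fun j => y j (i j))) `^ r) `^ r^-1 =
  P * (\sum_(i : {ffun {i | i \in S} -> 'I_M})
    rnorm (coord_restr U w (fun j => y j (i j))) `^ r) `^ r^-1.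
  have s0 : 0 <= \sum_(i : {ffun {i | i \in S} -> 'I_M})
      rnorm (coord_restr U w (fun j => y j (i j))) `^ r.
    by apply: sumr_ge0 => i _; exact: powR_ge0.
  rewrite -{1}(powR_inv_gt0K r0 P0) -powRM ?powR_ge0//; congr (_ `^ _).
  rewrite mulr_sumr; apply: eq_bigr => i _.
  by rewrite /coord_restr gE rnorm_multilinear_scale// prodE powRM ?rnorm_ge0.
by rewrite mulrAC mulrC ler_wpM2r//; exact: hC.
Qed.

Lemma coord_norms_restr_le (S : {set I}) (r C : R) (M : nat)
    (x : forall j, 'I_M.+1 -> X j) (z : forall i, X i) :
  multilinear U -> 0 < r -> 0 <= C ->
  (forall x, in_unit_balls x -> summing_bound r (@coord_restr R k I X Y U S x) C) ->
  (forall j, j \notin S -> rnorm (z j) <= weak_l1_norm (x j)) ->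
  coord_norms (samples R x) (fun=> r) (enum S) F z <= C * \prod_i weak_l1_norm (x i).
Proof.
move=> Um r0 C0 hC zx; rewrite -sum_sub_coord_norms//.
apply: le_trans (summing_bound_restr Um r0 C0 hC _ (fun j => x (val j))) _.
rewrite -mulrA ler_wpM2l// (bigID (mem S))/= mulrC.
rewrite prod_sig; apply: ler_wpM2l.
  by apply: prodr_ge0 => j _; exact: weak_l1_ge0.
rewrite [leRHS](eq_bigl (mem (~: S))) => [|i]; last by rewrite inE finset.in_setC.
rewrite prod_sig; apply: ler_prod => j _; rewrite rnorm_ge0 zx//.
by have := valP j; rewrite finset.in_setC.
Qed.

(** The cotype inequality for the values of U at the vectors of the family; by
    linearity in the coordinate j the signed sums of these values are the
    values at the signed sums. *)
Lemma coord_norm_cotype (q r A : R) (M : nat) (x : forall j, 'I_M -> X j) j z :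
  multilinear U ->
  (forall y : 'I_M -> Y, (\sum_j rnorm (y j) `^ q) `^ q^-1 <= A * rademacher_mean r y) ->
  coord_norm (samples R x j) q F z <= A * coord_norm (rademacher_sums x j) r F z.
Proof.
move=> Um hA; have [L LE] := multilinear_pack Um z j.
have := hA (fun t => U (dfwith z j (x j t))); rewrite rademacher_meanE.
rewrite /coord_norm/= => h.
have -> : \sum_(t < M) 1 * rnorm (U (dfwith z j (x j t))) `^ q =
    \sum_(t < M) rnorm (U (dfwith z j (x j t))) `^ q.
  by apply: eq_bigr => t _; rewrite mul1r.
apply: le_trans h _; rewrite le_eqVlt; apply/orP; left; apply/eqP.
congr (_ * _ `^ _); apply: eq_bigr => i _; congr (_ * rnorm _ `^ _).
rewrite -LE raddf_sum; apply: eq_bigr => t _.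
by rewrite raddfMz /= LE.
Qed.

(** Bring the l_r-norm over S outside, replace the l_q-norms over the other
    coordinates by L_r-averages over signs, and exchange the two. What remains
    is an average of l_r-sums over S at points whose other coordinates are
    signed sums, and these have norm at most the weak norm. *)
Lemma mixed_norm_le (S : {set I}) (q r A C : R) (M : nat)
    (x : forall j, 'I_M.+1 -> X j) (z : forall i, X i) :
  multilinear U -> 0 < r -> r <= q -> 0 <= A -> 0 <= C ->
  (forall M (y : 'I_M -> Y), (\sum_j rnorm (y j) `^ q) `^ q^-1 <= A * rademacher_mean r y) ->
  (forall x, in_unit_balls x -> summing_bound r (@coord_restr R k I X Y U S x) C) ->
  coord_norms (samples R x) (fun j => if j \in S then r else q) (enum I) F z
  <= A ^+ (#|I| - #|S|) * (C * \prod_i weak_l1_norm (x i)).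
Proof.
move=> Um r0 rq A0 C0 hA hC; have q0 : 0 < q by apply: lt_le_trans rq.
have F0 : forall z, 0 <= F z by move=> ?; exact: rnorm_ge0.
apply: le_trans (coord_norms_sort _ (mem S) (enum_uniq I) r0 rq F0 z) _.
have -> : [seq j <- enum I | mem S j] = enum S by rewrite !enumT.
set s := [seq j <- enum I | ~~ _].
have us : uniq s by rewrite filter_uniq ?enum_uniq.
have sS j : (j \in s) = (j \notin S) by rewrite mem_filter mem_enum andbT.
have size_s : size s = (#|I| - #|S|)%N.
  rewrite -(cardsC S) addKn cardE; apply: perm_size.
  by apply: uniq_perm => [//||j]; rewrite ?enum_uniq// mem_enum finset.in_setC sS.
have fs z' : 0 <= coord_norms (rademacher_sums x) (fun=> r) s F z'.
  exact: coord_norms_ge0.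
apply: (@le_trans _ _ (coord_norms (samples R x) (fun=> r) (enum S)
   (fun z => A ^+ size s * coord_norms (rademacher_sums x) (fun=> r) s F z) z)).
  apply: coord_norms_le => // z'; first exact: coord_norms_ge0.
  apply: coord_norms_trade => // j z'' _; exact: coord_norm_cotype.
rewrite coord_normsZ ?exprn_ge0// size_s ler_wpM2l ?exprn_ge0//.
apply: le_trans (coord_norms_exchange _ _ r0 _ F0 z) _.
  by move=> j; rewrite sS mem_enum.
apply: (@coord_norms_le_bound R I X _ (fun j u => rnorm u <= weak_l1_norm (x j))) => //.
- by rewrite mulr_ge0// prodr_ge0// => i _; exact: weak_l1_ge0.
- by apply: coord_norms_ge0.
- by move=> j _ /=; rewrite card_ord natrX mulVf// expf_neq0.
- move=> j t _ /=.
  exact: (rnorm_signed_sum_le (x j) (fun s => t %/ 2 ^ (M.+1.-1 - s))%N).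
- move=> z' _ z'x; apply: coord_norms_restr_le => // j jS.
  by apply: z'x; rewrite sS.
Qed.

(** A given j belongs to the proportion n / #|I| of the subsets with n
    elements; the binomial identity behind it counts the subsets that avoid j.
    *)
Lemma sum_draws (n : nat) (a b : R) (j : I) : (n <= #|I|)%N ->
  \sum_(S : {set I} | #|S| == n) (if j \in S then a else b) / 'C(#|I|, n)%:R
  = (n%:R * a + (#|I| - n)%:R * b) / #|I|%:R.
Proof.
move=> nI; rewrite -mulr_suml; set N := #|I|.
have N0 : (0 < N)%N by apply/card_gt0P; exists j.
have cN : 'C(N, n)%:R != 0 :> R by rewrite pnatr_eq0 -lt0n bin_gt0.
have cI : \sum_(S : {set I} | #|S| == n) 1 = 'C(N, n)%:R :> R.
  by rewrite -(card_draws I n) -sum1_card natr_sum; apply: eq_bigl => S; rewrite inE.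
have cj : \sum_(S : {set I} | (#|S| == n) && (j \notin S)) 1 = 'C(N.-1, n)%:R :> R.
  rewrite -(cardsC1 j) -cards_draws -sum1_card natr_sum; apply: eq_bigl => S.
  by rewrite inE andbC finset.subsetC finset.sub1set finset.in_setC.
rewrite (bigID (fun S : {set I} => j \in S))/=.
rewrite (eq_bigr (fun=> a * 1)) => [|S /andP[_ ->]]; last by rewrite mulr1.
rewrite [X in _ + X](eq_bigr (fun=> b * 1)) => [|S /andP[_ /negbTE ->]]; last by rewrite mulr1.
rewrite -!mulr_sumr cj.
have -> : \sum_(S : {set I} | (#|S| == n) && (j \in S)) 1 = 'C(N, n)%:R - 'C(N.-1, n)%:R :> R.
  by rewrite -cI [in RHS](bigID (fun S : {set I} => j \in S))/= cj addrK.
have bin : N%:R * 'C(N.-1, n)%:R = (N%:R - n%:R) * 'C(N, n)%:R :> R.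
  by rewrite -natrB// -!natrM mul_bin_down.
have N0' : N%:R != 0 :> R by rewrite pnatr_eq0 -lt0n.
have {}bin : 'C(N.-1, n)%:R = (N%:R - n%:R) * 'C(N, n)%:R / N%:R :> R.
  by rewrite -bin mulrAC divff// mul1r.
by rewrite bin natrB//; field; rewrite N0' cN.
Qed.

Lemma prod_draws (n : nat) (a : R) : (n <= #|I|)%N -> 0 <= a ->
  \prod_(S : {set I} | #|S| == n) a `^ 'C(#|I|, n)%:R^-1 = a.
Proof.
move=> nI a0; have c0 : 'C(#|I|, n)%:R != 0 :> R by rewrite pnatr_eq0 -lt0n bin_gt0.
rewrite -[RHS](powRr1 a0) -[in RHS](mulVf c0) powRrM powR_mulrn ?powR_ge0//.
set b := a `^ _^-1; rewrite -[in RHS](card_draws I n) -prodr_const.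
by apply: eq_bigl => S; rewrite inE.
Qed.

(** The function F is the product of its powers F ^ (1 / 'C(#|I|, n)), one for
    each S; the mixed-norm Hoelder inequality assigns to the factor of S the
    exponent r on S and q elsewhere. *)
Theorem summing_bound_interpolated (n : nat) (q r A : R) (C : {set I} -> R) :
  multilinear U -> 0 < r -> r <= q -> 0 <= A -> (n < #|I|)%N ->
  (forall S : {set I}, #|S| = n -> 0 <= C S) ->
  (forall M (y : 'I_M -> Y), (\sum_j rnorm (y j) `^ q) `^ q^-1 <= A * rademacher_mean r y) ->
  (forall S : {set I}, #|S| = n -> forall x, in_unit_balls x ->
     summing_bound r (@coord_restr R k I X Y U S x) (C S)) ->
  summing_bound (interp_exponent q r n #|I|) U
    (A ^+ (#|I| - n) * \prod_(S : {set I} | #|S| == n) C S `^ 'C(#|I|, n)%:R^-1).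
Proof.
move=> Um r0 rq A0 nI C0 hA hC; set rho := interp_exponent _ _ _ _.
have q0 : 0 < q by apply: lt_le_trans rq.
have N0 : (0 < #|I|)%N by apply: leq_ltn_trans nI.
have c0 : 0 < 'C(#|I|, n)%:R :> R by rewrite ltr0n bin_gt0 ltnW.
have den0 : 0 < n%:R * q + (#|I| - n)%:R * r.
  by rewrite ltr_wpDl// ?mulr_ge0 ?(ltW q0)// mulr_gt0// ltr0n subn_gt0.
have rho0 : 0 < rho.
  by rewrite divr_gt0// !mulr_gt0// ltr0n.
(* the empty family is separated because [sum_coord_norms] uses the index
   ord0; here the sum is empty, as I is not *)
move=> [|M] x.
  have [i0 _] : exists i : I, i \in I by apply/card_gt0P.
  rewrite big1 => [|h _]; last by case: (h i0).
  rewrite powR0 ?invr_neq0 ?gt_eqF// mulr_ge0 ?mulr_ge0 ?exprn_ge0//.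
    by apply: prodr_ge0 => S _; exact: powR_ge0.
  by apply: prodr_ge0 => i _; exact: weak_l1_ge0.
pose z0 i : X i := 0.
have F0 : forall z, 0 <= F z by move=> ?; exact: rnorm_ge0.
rewrite (sum_coord_norms x z0)//.
have -> : F = (fun z => \prod_(S : {set I} | #|S| == n) F z `^ 'C(#|I|, n)%:R^-1).
  by apply/funext => z; rewrite prod_draws// ltnW.
pose p (S : {set I}) j := if j \in S then r else q.
have p0 S j : 0 < p S j by rewrite /p; case: ifP.
apply: le_trans (@coord_norms_hoelder R I X _ (fun S : {set I} => #|S| == n) _ rho p
  (fun=> 'C(#|I|, n)%:R^-1) (enum I) (fun _ => F) rho0 _ _ _ _ z0) _.
- by move=> S _; rewrite invr_gt0.
- by move=> S j _; exact: p0.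
- move=> j; rewrite (eq_bigr (fun S : {set I} =>
    (if j \in S then r^-1 else q^-1) / 'C(#|I|, n)%:R)); last first.
    by move=> S _; rewrite mulrC /p; case: ifP.
  rewrite sum_draws ?(ltnW nI)// /rho /interp_exponent.
  by field; rewrite !gt_eqF// ltr0n.
- by move=> S z _; exact: F0.
have W0 : 0 <= \prod_i weak_l1_norm (x i) by apply: prodr_ge0 => i _; exact: weak_l1_ge0.
apply: le_trans (_ : \prod_(S : {set I} | #|S| == n)
   (A ^+ (#|I| - n) * (C S * \prod_i weak_l1_norm (x i))) `^ 'C(#|I|, n)%:R^-1 <= _).
  apply: ler_prod => S /eqP Sn; rewrite powR_ge0/=; apply: ge0_ler_powR.
  - by rewrite invr_ge0 ltW.
  - by rewrite nnegrE; exact: coord_norms_ge0.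
  - by rewrite nnegrE !mulr_ge0 ?exprn_ge0 ?C0.
  - by rewrite -Sn; apply: mixed_norm_le => //; [exact: C0|exact: hC].
rewrite (eq_bigr (fun S => (A ^+ (#|I| - n)) `^ 'C(#|I|, n)%:R^-1 * (C S `^ 'C(#|I|, n)%:R^-1 *
   (\prod_i weak_l1_norm (x i)) `^ 'C(#|I|, n)%:R^-1))) => [|S /eqP Sn]; last first.
  have CS0 := C0 S Sn; have AN0 : 0 <= A ^+ (#|I| - n) by rewrite exprn_ge0.
  by rewrite -(powRM _ CS0 W0) -(powRM _ AN0)// mulr_ge0.
rewrite !big_split/= !prod_draws ?exprn_ge0 ?(ltnW nI)//.
by rewrite mulrA.
Qed.

End core.

(** * Summing constants of restricted maps *)

Lemma le_of_forall_eps (R : realType) (a C P : R) : 0 <= P ->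
  (forall e, 0 < e -> a <= (C + e) * P) -> a <= C * P.
Proof.
move=> P0 h; apply/ler_addgt0Pr => e e0.
have P1 : 0 < P + 1 by rewrite ltr_wpDl.
apply: le_trans (h (e / (P + 1)) (divr_gt0 e0 P1)) _.
rewrite mulrDl lerD2l mulrAC ler_pdivrMr// ler_pM2l//; lra.
Qed.

Section summing_norm_theory.
Variables (R : realType) (k : scalar_kind) (I : finType).
Variables (X : I -> completeNormedModType (scalars R k)).
Variables (Y : completeNormedModType (scalars R k)) (V : (forall i, X i) -> Y).

Lemma summing_norm_le (r C : R) : 0 <= C -> summing_bound r V C ->
  (summing_norm r V <= C%:E)%E.
Proof.
move=> C0 VC; apply/lee_addgt0Pr => e e0; apply: ereal_inf_lbound.
exists (C + e); last by rewrite EFinD.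
split; first by rewrite ltr_wpDl.
by apply: summing_bound_le VC; rewrite lerDl ltW.
Qed.

Lemma summing_norm_ge0 (r : R) : (0 <= summing_norm r V)%E.
Proof. by apply: le_ereal_inf_tmp => _ [C [C0 _] <-]; rewrite lee_fin ltW. Qed.

Lemma summing_norm_bound (r C : R) : (summing_norm r V <= C%:E)%E -> summing_bound r V C.
Proof.
move=> VC M y; apply: le_of_forall_eps => [|e e0].
  by apply: prodr_ge0 => j _; exact: weak_l1_ge0.
have : (summing_norm r V < (C + e)%:E)%E by apply: le_lt_trans VC _; rewrite lte_fin ltrDl.
move=> /ereal_inf_lt[_ [C' [_ VC'] <-]]; rewrite lte_fin => CC'.
by apply: summing_bound_le VC' M y; exact: ltW.
Qed.

End summing_norm_theory.

Section uniform_summing.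
Variables (R : realType) (k : scalar_kind) (I : finType).
Variables (X : I -> completeNormedModType (scalars R k)).
Variables (Y : completeNormedModType (scalars R k)) (U : (forall i, X i) -> Y).
Variables (S : {set I}) (r : R).
Hypotheses (hU : bounded_multilinear U) (r1 : 1 <= r).
Hypothesis hS : forall x, multiple_summing r (@coord_restr R k I X Y U S x).

Let family_in_S := {M : nat & forall j : {i | i \in S}, 'I_M -> X (val j)}.

(** The left-hand side of the summing inequality for the restriction of U to S
    at z. *)
Let gauge (y : family_in_S) (z : forall i, X i) : R :=
  (\sum_(h : {ffun {i | i \in S} -> 'I_(projT1 y)})
     rnorm (coord_restr U (fun l : {i | i \in ~: S} => z (val l))
              (fun j => projT2 y j (h j))) `^ r) `^ r^-1.

Let weight (y : family_in_S) : R := \prod_j weak_l1_norm (projT2 y j).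

Let nondegenerate := {y : family_in_S | 0 < weight y}.

Let r0 : 0 < r. Proof. exact: lt_le_trans r1. Qed.

(** An l_r-sum of norms of values of linear maps, which is what the uniform
    boundedness principle asks for in the coordinate i. *)
Lemma gauge_coord_seminorm (y : family_in_S) (z : forall i, X i) (i : I) : i \notin S ->
  [/\ forall u v, gauge y (dfwith z i (u + v)) <= gauge y (dfwith z i u) + gauge y (dfwith z i v),
      forall a u, gauge y (dfwith z i (embed k a *: u)) = `|a| * gauge y (dfwith z i u)
    & exists C, forall u, gauge y (dfwith z i u) <= C * rnorm u].
Proof.
move=> iS; case: y => M y.
pose g (h : {ffun {i | i \in S} -> 'I_M}) :=
  glue_coords (fun l : {i | i \in ~: S} => z (val l)) (fun j => y j (h j)).
have gE u : gauge (existT _ M y) (dfwith z i u) =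
    (\sum_(h : {ffun {i | i \in S} -> 'I_M}) rnorm (U (dfwith (g h) i u)) `^ r) `^ r^-1.
  rewrite /gauge /=; congr (_ `^ _); apply: eq_bigr => h _.
  by rewrite /coord_restr glue_coords_dfwith_out.
have L h := multilinear_pack hU.1 (g h) i.
have rV0 : 0 <= r^-1 by rewrite invr_ge0 ltW.
have s0 (f : {ffun {i | i \in S} -> 'I_M} -> R) : 0 <= \sum_h f h `^ r.
  by apply: sumr_ge0 => h _; exact: powR_ge0.
split=> [u v|a u|].
- rewrite !gE.
  apply: le_trans (minkowski_sum r1 (fun h => rnorm_ge0 (U (dfwith (g h) i u)))
    (fun h => rnorm_ge0 (U (dfwith (g h) i v)))).
  apply: ge0_ler_powR; rewrite ?nnegrE//; apply: ler_sum => h _.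
  apply: ge0_ler_powR; rewrite ?nnegrE ?(ltW r0) ?addr_ge0 ?rnorm_ge0//.
  by have [l lE] := L h; rewrite -!lE raddfD; exact: ler_rnormD.
- rewrite !gE -[X in _ = X * _](powR_inv_gt0K r0 (normr_ge0 a)) -powRM ?powR_ge0//.
  congr (_ `^ _); rewrite mulr_sumr; apply: eq_bigr => h _.
  have [l lE] := L h; rewrite -!lE linearZ/= rnormZr powRM ?rnorm_ge0//.
- have [C C0 UC] := bounded_multilinear_le hU.
  pose c h := C * \prod_(l | l != i) rnorm (g h l).
  have c0 h : 0 <= c h by rewrite mulr_ge0// prodr_ge0// => l _; exact: rnorm_ge0.
  exists ((\sum_h c h `^ r) `^ r^-1) => u; rewrite gE.
  rewrite -[X in _ * X](powR_inv_gt0K r0 (rnorm_ge0 u)) -powRM ?powR_ge0//.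
  apply: ge0_ler_powR; rewrite ?nnegrE ?mulr_ge0 ?powR_ge0//.
  rewrite mulr_suml; apply: ler_sum => h _; rewrite -powRM ?rnorm_ge0//.
  have cu0 : 0 <= c h * rnorm u by apply: mulr_ge0 => //; exact: rnorm_ge0.
  apply: ge0_ler_powR; rewrite ?nnegrE ?(ltW r0) ?rnorm_ge0//.
  apply: le_trans (UC _) _; rewrite (bigD1 i)//= dfwithin /c -mulrA ler_wpM2l//.
  rewrite mulrC ler_wpM2r ?rnorm_ge0// le_eqVlt; apply/orP; left; apply/eqP.
  by apply: eq_bigr => l li; rewrite dfwithout// eq_sym.
Qed.

(** Induction on the list of coordinates that range over their unit balls. To
    add the coordinate j, the uniform boundedness principle is applied in X j
    to the family indexed by the vector families y and by all values in the
    unit balls of the coordinates treated before; the induction hypothesis is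
    its pointwise boundedness. *)
Lemma gauge_uniform (s : seq I) : uniq s -> {subset s <= ~: S} ->
  forall z, exists C, forall (y : nondegenerate) z', (forall i, i \notin s -> z' i = z i) ->
    (forall i, i \in s -> rnorm (z' i) <= 1) -> gauge (val y) z' / weight (val y) <= C.
Proof.
elim: s => [_ _ z|j s IHs /= /andP[js us] sS z].
  have [_ [C C0 hC]] := hS (fun l => z (val l)).
  exists C => y z' z'z _.
  have -> : z' = z by apply: functional_extensionality_dep => i; exact: z'z.
  by rewrite ler_pdivrMr ?(valP y)//; exact: hC.
have {}IHs := IHs us (fun i si => sS i (mem_behead (s := j :: s) si)).
have jS : j \notin S by have := sS j (mem_head _ _); rewrite finset.in_setC.
pose J := {t : nondegenerate * (forall i, X i) | (forall i, i \notin j :: s -> t.2 i = z i) /\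
   (forall i, i \in s -> rnorm (t.2 i) <= 1)}.
pose p (t : J) u := gauge (val (sval t).1) (dfwith (sval t).2 j u) / weight (val (sval t).1).
have w0 (y : nondegenerate) : 0 < weight (val y) by exact: valP y.
have [||||C hC] := @uniform_boundedness R k (X j) J p.
- move=> t u v; rewrite /p -mulrDl ler_pM2r ?invr_gt0//.
  by have [h _ _] := gauge_coord_seminorm (val (sval t).1) (sval t).2 jS; exact: h.
- move=> t a u; rewrite /p.
  by have [_ -> _] := gauge_coord_seminorm (val (sval t).1) (sval t).2 jS; rewrite mulrA.
- move=> t; have [_ _ [C hC]] := gauge_coord_seminorm (val (sval t).1) (sval t).2 jS.
  exists (C / weight (val (sval t).1)) => u.
  by rewrite /p mulrAC ler_pM2r ?invr_gt0.
- move=> u; have [C hC] := IHs (dfwith z j u); exists C => -[[y z'] [/= z'z z'1]].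
  rewrite /p/=; apply: hC => i si.
    exact: (eq_off_dfwith u z'z si).
  by rewrite dfwithout ?z'1//; apply: contraNneq js => ->.
exists C => y z' z'z z'1.
have t : (forall i, i \notin j :: s -> z' i = z i) /\ (forall i, i \in s -> rnorm (z' i) <= 1).
  by split=> // i si; apply: z'1; rewrite inE si orbT.
have := hC (exist _ (y, z') t : J) (z' j); rewrite /p/= dfwith_id; apply.
by apply: z'1; exact: mem_head.
Qed.

(** The quotients of [gauge_uniform] exist only for families whose weak norms
    are all nonzero. For the other families the bound at the single point x
    already gives 0 on the left-hand side. *)
Lemma summing_bound_uniform : exists2 C, 0 <= C &
  forall x, in_unit_balls x -> summing_bound r (@coord_restr R k I X Y U S x) C.
Proof.
have sub : {subset enum (~: S) <= ~: S} by move=> i; rewrite mem_enum.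
have [C hC] := gauge_uniform (enum_uniq _) sub (fun=> 0).
exists `|C| => // x x1 M y.
pose z := @glue_coords R k I X S x (fun=> 0).
have zx : (fun l : {i | i \in ~: S} => z (val l)) = x.
  by apply: functional_extensionality_dep => l; exact: glue_coords_out.
have gaugeE : gauge (existT _ M y) z = (\sum_(i : {ffun {i | i \in S} -> 'I_M})
    rnorm (coord_restr U x (fun j => y j (i j))) `^ r) `^ r^-1.
  by rewrite /gauge/= zx.
rewrite -gaugeE; have W0 : 0 <= weight (existT _ M y).
  by apply: prodr_ge0 => j _; exact: weak_l1_ge0.
move: W0; rewrite le_eqVlt => /orP[/eqP W0|Wp].
  have [_ [C' C'0 hC']] := hS x.
  by have := hC' M y; rewrite gaugeE -/(weight (existT _ M y)) -W0 !mulr0.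
have : gauge (existT _ M y) z / weight (existT _ M y) <= C.
  apply: (hC (exist (fun y : family_in_S => 0 < weight y) _ Wp) z) => i.
    rewrite mem_enum finset.in_setC negbK => iS.
    by have [j <-] := in_set_sig iS; rewrite /z glue_coords_in.
  rewrite mem_enum => /in_set_sig[j <-].
  by rewrite /z glue_coords_out; exact: x1.
rewrite (ler_pdivrMr _ _ Wp) => h; apply: le_trans h _.
exact: ler_wpM2r (ltW Wp) _ _ (ler_norm C).
Qed.

End uniform_summing.

Section nested.
Variables (R : realType) (k : scalar_kind) (I : finType).
Variables (X : I -> completeNormedModType (scalars R k)).
Variables (Y : completeNormedModType (scalars R k)) (U : (forall i, X i) -> Y).

(** Restricting first to D and then to S inside D is restricting to the image
    of S, up to a bijection h of the index types. Families are carried along h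
    by gluing them into points of the whole product, which avoids casts
    between the types of the vectors. *)
Lemma multiple_summing_nested (r : R) (D : {set I}) (S : {set {i | i \in D}})
    (x : forall j, subfamily X (~: D) j)
    (x' : forall j, subfamily (subfamily X D) (~: S) j) :
  bounded_multilinear U ->
  (forall w, multiple_summing r (@coord_restr R k I X Y U (val @: S) w)) ->
  multiple_summing r (coord_restr (coord_restr U x) x').
Proof.
move=> hU hS; split; first by do 2!apply: bounded_multilinear_restr.
pose E := (val @: S)%SET.
pose full (y : forall j, subfamily (subfamily X D) S j) : forall i, X i :=
  glue_coords x (glue_coords x' y).
have [_ [C C0 hC]] := hS (fun l => full (fun=> 0) (val l)).
exists C => // M y.
have hE (j : {j | j \in S}) : val (val j) \in E by apply: finset.imset_f; exact: valP.
pose h j : {i | i \in E} := exist _ (val (val j)) (hE j).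
have h_bij : bijective h.
  apply: inj_card_bij => [j1 j2 [/val_inj/val_inj //]|].
  by rewrite !card_sig -[X in (X <= _)%N]/#|E| /E finset.card_imset//; exact: val_inj.
have [h' hK h'K] := h_bij.
pose y' (i : {i | i \in E}) (t : 'I_M) : X (val i) := full (fun j => y j t) (val i).
have y'h j : y' (h j) = y j.
  apply/funext => t; rewrite /y' /full /=.
  by rewrite glue_coords_in glue_coords_in.
have := hC M y'.
have -> : \prod_j weak_l1_norm (y' j) = \prod_j weak_l1_norm (y j).
  rewrite (reindex h); last exact: onW_bij.
  apply: eq_bigr => j _.
  by rewrite y'h.
apply: le_trans; rewrite le_eqVlt; apply/orP; left; apply/eqP; congr (_ `^ _).
pose e (f : {ffun {i | i \in E} -> 'I_M}) : {ffun {j | j \in S} -> 'I_M} := [ffun j => f (h j)].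
have e_bij : bijective e.
  exists (fun f : {ffun {j | j \in S} -> 'I_M} => [ffun i => f (h' i)]) => f;
    apply/ffunP => i; rewrite !ffunE.
    by rewrite h'K.
  by rewrite hK.
rewrite (reindex e); last exact: onW_bij.
apply: eq_bigr => f _.
congr (rnorm _ `^ _); rewrite /coord_restr; congr U.
apply/esym/glue_coordsP => l.
  have [j ->] : exists j : {j | j \in S}, l = h j by exists (h' l); rewrite h'K.
  by rewrite [RHS](congr1 (fun g => g (f (h j))) (y'h j)) /= !glue_coords_in ffunE.
rewrite /full; have lE : val l \notin E by have := valP l; rewrite finset.in_setC.
have [lD|] := boolP (val l \in D); last first.
  by rewrite -finset.in_setC => /in_set_sig[j <-]; rewrite !glue_coords_out.
have [j jl] := in_set_sig lD; rewrite -jl !glue_coords_in.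
have : j \in ~: S.
  by rewrite finset.in_setC; apply: contra lE => jS; rewrite -jl finset.imset_f.
by move=> /in_set_sig[j' <-]; rewrite !glue_coords_out.
Qed.

End nested.

(** * Coordinatewise summing operators *)

Section conclusion.
Variables (R : realType) (k : scalar_kind).
Variables (Y : completeNormedModType (scalars R k)) (q r : R).

(** The inequality for constants above the infimum passes to the limit. *)
Lemma cotype_const_bound : has_cotype Y q -> cotype_bound Y q (cotype_const Y q).
Proof.
move=> [C0 C0p hC0] n y; have m0 : 0 <= rademacher_mean 2 y by exact: powR_ge0.
apply: le_of_forall_eps => // e e0.
have hi : has_inf [set C : R | 0 < C /\ cotype_bound Y q C].
  by split; [exists C0|exists 0 => C [/ltW]].
have [C [_ hC] Ce] := inf_adherent e0 hi.
apply: le_trans (hC n y) _; rewrite ler_wpM2r//; exact: ltW.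
Qed.

Lemma cotype_const_ge0 : has_cotype Y q -> 0 <= cotype_const Y q.
Proof.
by move=> [C0 C0p hC0]; apply: lb_le_inf => [|C [/ltW]//]; exists C0.
Qed.

Lemma cotype_kahane (K : R) : has_cotype Y q -> kahane_const k r 2 K ->
  forall M (y : 'I_M -> Y),
    (\sum_j rnorm (y j) `^ q) `^ q^-1 <= A_const Y q K * rademacher_mean r y.
Proof.
move=> hY [K0 hK] M y; apply: le_trans (cotype_const_bound hY y) _.
by rewrite /A_const -mulrA ler_wpM2l ?cotype_const_ge0.
Qed.

Variables (I : finType) (X : I -> completeNormedModType (scalars R k)).
Variables (U : (forall i, X i) -> Y) (n : nat).
Hypotheses (hY : has_cotype Y q) (r1 : 1 <= r) (rq : r <= q) (nI : (n < #|I|)%N).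
Hypothesis hU : bounded_multilinear U.
Hypothesis hS : forall S : {set I}, #|S| = n ->
  forall x, multiple_summing r (@coord_restr R k I X Y U S x).

Let r0 : 0 < r. Proof. exact: lt_le_trans r1. Qed.

(** This is the uniform boundedness of the summing norms, in the form that the
    interpolated estimate needs: as a product of extended reals its right-hand
    side involves no infinite factor. *)
Lemma coord_restr_norm_fin (S : {set I}) : #|S| = n ->
  exists2 c : R, 0 <= c & coord_restr_norm r U S = c%:E.
Proof.
move=> Sn; have [C C0 hC] := summing_bound_uniform hU r1 (hS Sn).
have ge0 : (0 <= coord_restr_norm r U S)%E.
  apply: le_trans (summing_norm_ge0 (@coord_restr R k I X Y U S (fun=> 0)) r) _.
  by apply: ereal_sup_ubound; exists (fun=> 0) => // j; rewrite rnorm0.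
have leC : (coord_restr_norm r U S <= C%:E)%E.
  by apply: ge_ereal_sup => _ [x x1 <-]; exact: summing_norm_le (hC x x1).
exists (fine (coord_restr_norm r U S)); first exact: fine_ge0.
by rewrite fineK// ge0_fin_numE//; apply: le_lt_trans leC (ltry _).
Qed.

Theorem summing_interpolated (K : R) : kahane_const k r 2 K ->
  exists2 c : R, 0 <= c /\ summing_bound (interp_exponent q r n #|I|) U c &
   c%:E = ((A_const Y q K ^+ (#|I| - n))%:E *
         \prod_(S : {set I} | #|S| == n)
           coord_restr_norm r U S `^ ('C(#|I|, n)%:R^-1))%E.
Proof.
move=> hK; pose c S := fine (coord_restr_norm r U S).
have cE (S : {set I}) : #|S| = n -> 0 <= c S /\ coord_restr_norm r U S = (c S)%:E.
  by move=> Sn; rewrite /c; have [d d0 ->] := coord_restr_norm_fin Sn.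
have A0 : 0 <= A_const Y q K by rewrite mulr_ge0 ?cotype_const_ge0// ltW//; case: hK.
have A0' : 0 <= A_const Y q K ^+ (#|I| - n) by rewrite exprn_ge0.
exists (A_const Y q K ^+ (#|I| - n) *
    \prod_(S : {set I} | #|S| == n) c S `^ 'C(#|I|, n)%:R^-1); last first.
  rewrite EFinM -prodEFin; congr (_ * _)%E.
  by apply: eq_bigr => S /eqP/cE[_ ->]; rewrite poweR_EFin.
split; first by rewrite mulr_ge0// prodr_ge0// => S _; exact: powR_ge0.
apply: summing_bound_interpolated => //; first exact: hU.1.
- by move=> S /cE[].
- exact: cotype_kahane.
- move=> S /cE[c0 cS] x x1; apply: summing_norm_bound.
  by rewrite -cS; apply: ereal_sup_ubound; exists x.
Qed.

Lemma multiple_summing_interpolated : multiple_summing (interp_exponent q r n #|I|) U.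
Proof.
have [K hK] := kahane_const_exists k r1.
have [c [c0 hc] _] := summing_interpolated hK.
split=> //; exists (c + 1); first by rewrite ltr_wpDl.
by apply: summing_bound_le hc; rewrite lerDl.
Qed.

End conclusion.

Theorem theorem4p2 (R : realType) (k : scalar_kind) (m n : nat) (q r : R)
    (X : 'I_m -> completeNormedModType (scalars R k))
    (Y : completeNormedModType (scalars R k))
    (U : (forall i, X i) -> Y)
    (hq : 2 <= q) (hY : has_cotype Y q)
    (hr : 1 <= r) (hrq : r <= q)
    (hn : (1 <= n)%N) (hnm : (n < m)%N)
    (hU : bounded_multilinear U)
    (hsep : separately_summing n r U) :
  (forall N : nat, (n < N)%N -> (N <= m)%N ->
     separately_summing N (interp_exponent q r n N) U)
  /\
  (forall K : R, kahane_const k r 2 K ->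
     (forall N : nat, (n < N)%N -> (N < m)%N ->
        forall D : {set 'I_m}, #|D| = N ->
        forall x : (forall j, subfamily X (~: D) j),
          (summing_norm (interp_exponent q r n N) (coord_restr U x)
           <= (A_const Y q K ^+ (N - n))%:E *
              \prod_(S : {set {i : 'I_m | i \in D}} | #|S| == n)
                coord_restr_norm r (coord_restr U x) S `^ ('C(N, n)%:R^-1))%E)
     /\
     (summing_norm (interp_exponent q r n m) U
      <= (A_const Y q K ^+ (m - n))%:E *
         \prod_(S : {set 'I_m} | #|S| == n)
           coord_restr_norm r U S `^ ('C(m, n)%:R^-1))%E).
Proof.
have small (S : {set 'I_m}) : #|S| = n ->
    forall x, multiple_summing r (@coord_restr R k _ X Y U S x).
  move=> Sn; have := hsep S Sn; rewrite /multiple_summing_in; case: eqP => // ST.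
  by move: hnm; rewrite -Sn ST cardsT card_ord ltnn.
have mE : #|'I_m| = m := card_ord m.
have cardD (D : {set 'I_m}) : #|{: {i : 'I_m | i \in D}}| = #|D| by rewrite card_sig.
have nested (D : {set 'I_m}) (x : forall j, subfamily X (~: D) j) (S : {set {i | i \in D}}) :
    #|S| = n -> forall x', multiple_summing r (@coord_restr R k _ _ Y (coord_restr U x) S x').
  move=> Sn x'; apply: multiple_summing_nested => // w; apply: small.
  by rewrite finset.card_imset//; exact: val_inj.
split=> [N nN Nm D DN|K hK].
  rewrite /multiple_summing_in; case: eqP => [DT|_ x].
    have -> : N = #|'I_m| by rewrite -DN DT cardsT.
    by apply: multiple_summing_interpolated => //; rewrite mE.
  rewrite -DN -cardD; apply: multiple_summing_interpolated => //.
  - by rewrite cardD DN.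
  - exact: bounded_multilinear_restr.
  - exact: nested.
split=> [N nN Nm D DN x|].
  have nD : (n < #|{: {i : 'I_m | i \in D}}|)%N by rewrite cardD DN.
  have [c [c0 hc]] := summing_interpolated hY hr hrq nD (bounded_multilinear_restr x hU)
    (nested D x) hK.
  by rewrite cardD DN in hc *; move=> <-; exact: summing_norm_le.
have nm : (n < #|'I_m|)%N by rewrite mE.
have [c [c0 hc]] := summing_interpolated hY hr hrq nm hU small hK.
by rewrite mE in hc *; move=> <-; exact: summing_norm_le.
Qed.
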